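(* Consider the finite chain of $N=4m+1$ resonators, made of dimers with spacings $s_1,s_2>0$ and with a geometric defect at the centre, described in the context. For $N$ large enough, there exists a unique interface mode with eigenfrequency $\omega_{\mathsf i}^{(N)}$ in the band gap. The decay rate of the interface mode converges to $$\beta=\frac1L\operatorname{arcosh}\left(\frac{s_1s_2}{2}\left(\left(\frac{\omega_{\mathsf i}^2}{\delta}-\frac1{s_1}-\frac1{s_2}\right)^2-\frac1{s_1^2}-\frac1{s_2^2}\right)\right)$$ exponentially as $N\to\infty$, where $$\omega_{\mathsf i}=\sqrt{\delta\,\frac12\left(-\sqrt{\frac9{s_1^2}-\frac{14}{s_1s_2}+\frac9{s_2^2}}+\frac3{s_1}+\frac3{s_2}\right)}.$$
   Context: Structure: $D_1,\dots,D_{4m+1}$ are consecutive intervals of length $1$ on the line, with all wave speeds (inside the resonators and in the background) equal to $1$ and contrast parameter $\delta>0$. The spacing between $D_j$ and $D_{j+1}$ for $1\le j\le 2m$ is $s_1$ if $j$ is odd and $s_2$ if $j$ is even. The spacing between $D_j$ and $D_{j+1}$ for $2m+1\le j\le 4m$ is $s_2$ if $j$ is odd and $s_1$ if $j$ is even. Thus the central resonator $D_{2m+1}$ has spacing $s_2$ on both sides, and on each side of it the structure is a piece of a periodic chain of dimers with period $L=2+s_1+s_2$. Frequencies of the finite chain: subwavelength resonant frequencies are those tending to $0$ as $\delta\to0$. They are computed to leading order in $\delta$ by the capacitance matrix: writing $g_j$ for the spacing between $D_j$ and $D_{j+1}$, let $C$ be the symmetric tridiagonal $N\times N$ matrix with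 $C_{j,j+1}=C_{j+1,j}=-1/g_j$, $C_{11}=1/g_1$, $C_{NN}=1/g_{N-1}$ and $C_{jj}=1/g_{j-1}+1/g_j$ for $1<j<N$. The eigenfrequencies are $\omega=\sqrt{\delta\lambda}$ with $\lambda$ an eigenvalue of $C$, and the associated mode is the corresponding eigenvector. Bands and band gap: for the infinite periodic dimer chain with spacings $s_1,s_2$, a solution with complex quasimomentum $\alpha+\mathrm i\beta$ ($\alpha\in\mathbb R/(2\pi/L)\mathbb Z$, $\beta\in\mathbb R$) satisfies $u(x+L)=e^{\mathrm i(\alpha+\mathrm i\beta)L}u(x)$, so that $e^{-\beta L}$ governs its decay across one unit cell. The subwavelength bands ($\beta=0$) are, to leading order, $\omega=\sqrt{\delta\lambda}$ with $\lambda=\frac1{s_1}+\frac1{s_2}\pm\sqrt{\frac1{s_1^2}+\frac1{s_2^2}+\frac2{s_1s_2}\cos(\alpha L)}$; the band gap is the interval of frequencies between the two bands. For $\beta\ne0$, real frequencies occur for $\alpha\in\{0,\pm\pi/L\}$ and are, to leading order, the real values of $\omega=\sqrt{\delta\lambda}$ with $\lambda=\frac1{s_1}+\frac1{s_2}\pm\sqrt{\frac1{s_1^2}+\frac1{s_2^2}+\frac2{s_1s_2}\cosh(\beta L)}$ when $\alpha=0$ and $\lambda=\frac1{s_1}+\frac1{s_2}\pm\sqrt{\frac1{s_1^2}+\frac1{s_2^2}-\frac2{s_1s_2}\cosh(\beta L)}$ when $\alpha=\pm\pi/L$. An interface mode is an eigenmode of the finite chain, with eigenfrequency in the band gap, that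 decays exponentially away from the central defect in both directions. Its decay rate is the imaginary part $\beta$ of the complex quasimomentum of the periodic dimer chain associated with its eigenfrequency.
   Formalization: Assumes s1 ≠ s2 (otherwise no band gap); convergence to the displayed β is claimed only for s1 < s2 (for s1 > s2 the rate tends to ln(s1/s2)/L instead); arcosh, whose argument is below −1, is read as the real part of the principal complex arcosh. *)

(* Defs.v *)
From HB Require Import structures.
From mathcomp Require Import all_boot all_order all_algebra.
From mathcomp Require Import complex.
From mathcomp Require Import boolp classical_sets reals topology normedtype.
From mathcomp Require Import sequences exp trigo.

Set Implicit Arguments.
Unset Strict Implicit.
Unset Printing Implicit Defensive.

Import Order.TTheory GRing.Theory Num.Theory.
Import numFieldNormedType.Exports.

Local Open Scope ring_scope.

Definition cosh {R : realType} (x : R) : R := (expR x + expR (- x)) / 2.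

(* Real part of the principal value of arcosh at a real point, from
   arcosh z = Log (z + sqrt (z - 1) * sqrt (z + 1)) and Re (Log w) = ln |w|;
   [sqrtc] is the principal complex square root.  At x >= 1 this is the usual
   real arcosh.  At x < -1, arcosh x = arcosh (- x) + i * pi. *)
Definition Re_arcosh {R : realType} (x : R) : R :=
  let z : R[i] := (x%:C)%C in
  ln (ComplexField.Normc.normc (z + sqrtc (z - 1) * sqrtc (z + 1))).

(* Distance between D_k and D_(k+1), where k counts from 1. *)
Definition spacing {R : realType} (s1 s2 : R) (m k : nat) : R :=
  if (k <= 2 * m)%N then (if odd k then s1 else s2)
  else (if odd k then s2 else s1).

(* The ordinal i stands for the resonator D_(i+1), so that g i and g i.+1 are
   the spacings on its left and on its right. *)
Definition capacitance {R : realType} (N : nat) (g : nat -> R) : 'M[R]_N :=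
  \matrix_(i < N, j < N)
    if i == j then (if (0 < i)%N then (g i)^-1 else 0)
                   + (if (i.+1 < N)%N then (g i.+1)^-1 else 0)
    else if i.+1 == j then - (g i.+1)^-1
    else if j.+1 == i then - (g j.+1)^-1
    else 0.

Definition frequency {R : realType} (delta lambda : R) : R :=
  Num.sqrt (delta * lambda).

(* [eigenspace] consists of row vectors; the capacitance matrix is symmetric. *)
Definition eigenmode {R : realType} (s1 s2 delta : R) (m : nat) (omega : R)
    (u : 'rV[R]_(4 * m).+1) : Prop :=
  u != 0 /\
  exists2 lambda : R,
    (u <= eigenspace (capacitance (4 * m).+1 (spacing s1 s2 m)) lambda)%MS
    & omega = frequency delta lambda.

Definition cell_length {R : realType} (s1 s2 : R) : R := 2 + s1 + s2.

Definition radicand {R : realType} (s1 s2 c : R) : R :=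
  (s1 ^+ 2)^-1 + (s2 ^+ 2)^-1 + 2 / (s1 * s2) * c.

(* c plays the role of cos (k L), with k the real or complex quasimomentum. *)
Definition level {R : realType} (s1 s2 : R) (upper : bool) (c : R) : R :=
  s1^-1 + s2^-1
  + (if upper then Num.sqrt (radicand s1 s2 c)
     else - Num.sqrt (radicand s1 s2 c)).

Definition band {R : realType} (s1 s2 delta : R) (upper : bool) (alpha : R) : R :=
  frequency delta (level s1 s2 upper (cos (alpha * cell_length s1 s2))).

Definition in_band_gap {R : realType} (s1 s2 delta omega : R) : Prop :=
  forall alpha : R,
    band s1 s2 delta false alpha < omega < band s1 s2 delta true alpha.

(* The real frequencies with quasimomentum alpha + i beta, beta != 0.  As
   [Num.sqrt] vanishes on negative numbers, the two nonnegativity conditions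
   are what selects the real values of the frequency. *)
Definition complex_band {R : realType} (s1 s2 delta omega alpha beta : R) : Prop :=
  let L := cell_length s1 s2 in
  exists (upper : bool) (c : R),
    [/\ (alpha = 0 /\ c = cosh (beta * L))
        \/ (`|alpha| = pi / L /\ c = - cosh (beta * L)),
        0 <= radicand s1 s2 c, 0 <= level s1 s2 upper c
      & omega = frequency delta (level s1 s2 upper c)].

Definition decay_rate {R : realType} (s1 s2 delta omega beta : R) : Prop :=
  0 < beta /\ exists alpha : R, complex_band s1 s2 delta omega alpha beta.

(* Exponential decay on both sides of the central resonator (index 2 m), by a
   factor expR (- beta * L) for each unit cell of two resonators, up to the
   constant K; the norm of u is the maximum norm. *)
Definition decays_from_centre {R : realType} (s1 s2 K beta : R) (m : nat)
    (u : 'rV[R]_(4 * m).+1) : Prop :=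
  forall i : 'I_(4 * m).+1,
    let cells := ((maxn i (2 * m) - minn i (2 * m)) %/ 2)%N in
    `|u ord0 i| <= K * expR (- beta * cell_length s1 s2 * cells%:R) * `|u|.

(* On a single finite chain every vector satisfies the bound for some K: the
   condition is meaningful for a K that does not depend on m. *)
Definition interface_mode {R : realType} (s1 s2 delta K : R) (m : nat)
    (omega beta : R) (u : 'rV[R]_(4 * m).+1) : Prop :=
  [/\ eigenmode s1 s2 delta omega u,
      in_band_gap s1 s2 delta omega,
      decay_rate s1 s2 delta omega beta
    & decays_from_centre s1 s2 K beta u].

Definition omega_i {R : realType} (s1 s2 delta : R) : R :=
  Num.sqrt (delta * (2^-1 *
    (- Num.sqrt (9 / s1 ^+ 2 - 14 / (s1 * s2) + 9 / s2 ^+ 2)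
     + 3 / s1 + 3 / s2))).

(* For s1 < s2 the argument of arcosh is less than -1: the quasimomentum has
   real part pi / L, and its imaginary part is the real part of the principal
   arcosh divided by L. *)
Definition beta_i {R : realType} (s1 s2 delta : R) : R :=
  (cell_length s1 s2)^-1 *
  Re_arcosh (s1 * s2 / 2 *
    ((omega_i s1 s2 delta ^+ 2 / delta - s1^-1 - s2^-1) ^+ 2
     - (s1 ^+ 2)^-1 - (s2 ^+ 2)^-1)).

(* Main.v *)
Require Import Defs.
From mathcomp Require Import all_boot all_order all_algebra.
From mathcomp Require Import reals topology normedtype sequences exp.
From mathcomp Require Import complex boolp trigo.
From mathcomp Require Import ring lra zify.
Import Order.TTheory GRing.Theory Num.Theory.
Local Open Scope ring_scope.

(* Write a = 1/s1, b = 1/s2 and lambda = a + b - x; the gap is |x| < |a - b|.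
   Solving the eigenvalue equation inwards from an end of the chain gives two
   sequences u (even sites) and v (odd sites), with alternating signs removed, that
   satisfy f (n+2) = t f (n+1) - f n with t = z + 1/z and z = exp (beta L).  In the
   gap one of them dominates the other: u if s1 < s2, v if s2 < s1.  Gluing the two
   halves at the centre, only even modes are possible in the first case and only
   odd ones in the second, and the domination makes the inner product of any two
   such modes positive, so by orthogonality there is at most one.  The intermediate
   value theorem provides one, and its dominant sequence grows at least like z ^ n
   towards the centre.  If s1 < s2, the equation for x differs by O(z ^ (- 2 m)) from
   that of the infinite chain, which factors with x ^ 2 + (a + b) x - 2 (a - b) ^ 2. *)

Set Implicit Arguments.
Unset Strict Implicit.
Unset Printing Implicit Defensive.

(** * Modes of a chain of dimers seen from its end *)

(** The increments satisfy f (n+2) - f (n+1) = (t - 2) f (n+1) + (f (n+1) - f n), so none of them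
    becomes negative. *)
Lemma rec2_nondecreasing (R : realFieldType) (f : nat -> R) (t : R) :
  (forall n, f n.+2 = t * f n.+1 - f n) -> 2 <= t -> 0 <= f 0%N <= f 1%N ->
  forall n, 0 <= f n <= f n.+1.
Proof.
move=> frec t2 f01; elim=> // n /andP[fn0 fn1].
rewrite frec (le_trans fn0 fn1) /=; nra.
Qed.

Lemma rec2_ge0 (R : realFieldType) (f : nat -> R) (t : R) :
  (forall n, f n.+2 = t * f n.+1 - f n) -> 2 <= t -> 0 <= f 0%N <= f 1%N ->
  forall n, 0 <= f n.
Proof. by move=> frec t2 f01 n; case/andP: (rec2_nondecreasing frec t2 f01 n). Qed.

(** The characteristic roots are z and 1/z; removing the factor for z leaves a geometric sequence of
    ratio 1/z. *)
Lemma rec2_defect (R : fieldType) (f : nat -> R) (z : R) :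
  z != 0 -> (forall n, f n.+2 = (z + z^-1) * f n.+1 - f n) ->
  forall n, f n.+1 - z * f n = z^-1 ^+ n * (f 1%N - z * f 0%N).
Proof.
move=> z0 frec; elim=> [|n IHn]; first by rewrite expr0 mul1r.
by rewrite exprS -mulrA -IHn frec; field.
Qed.

(** The defect f (n+1) - z f n keeps its initial sign. *)
Lemma rec2_growth (R : realFieldType) (f : nat -> R) (z : R) :
  0 < z -> (forall n, f n.+2 = (z + z^-1) * f n.+1 - f n) ->
  z * f 0%N <= f 1%N -> forall n k, z ^+ k * f n <= f (n + k)%N.
Proof.
move=> z0 frec f01 n; elim=> [|k IHk]; first by rewrite expr0 mul1r addn0.
have := rec2_defect (lt0r_neq0 z0) frec (n + k); rewrite addnS => defect.
apply: le_trans (_ : z * f (n + k)%N <= _).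
  by rewrite exprS -mulrA ler_pM2l.
by rewrite -subr_ge0 defect mulr_ge0 ?exprn_ge0 ?invr_ge0 ?subr_ge0 ?(ltW z0).
Qed.

(* Up to the sign (-1) ^ n, the values of a mode at the sites 2 n and 2 n - 1
   counted from the end of the chain, for the eigenvalue a + b - x.  The end
   resonator has only one neighbour; this is the Neumann condition that the
   fictitious site -1 carries the same value as the site 0. *)
Fixpoint dimer (R : fieldType) (a b x : R) (n : nat) : R * R :=
  if n is n'.+1 then
    let: (u, v) := dimer a b x n' in
    let v' := (b * v - x * u) / a in ((a * u + x * v') / b, v')
  else (1, 1).

Definition dimer_u (R : fieldType) (a b x : R) n : R := (dimer a b x n).1.
Definition dimer_v (R : fieldType) (a b x : R) n : R := (dimer a b x n).2.

Arguments dimer_u : simpl never.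
Arguments dimer_v : simpl never.

(* Minus the trace of the transfer matrix of a unit cell: 2 cosh (beta L). *)
Definition cell_trace (R : fieldType) (a b x : R) : R := (a ^+ 2 + b ^+ 2 - x ^+ 2) / (a * b).

Lemma dimer_vS (R : fieldType) (a b x : R) n :
  dimer_v a b x n.+1 = (b * dimer_v a b x n - x * dimer_u a b x n) / a.
Proof. by rewrite /dimer_u /dimer_v /=; case: (dimer a b x n). Qed.

Lemma dimer_uS (R : fieldType) (a b x : R) n :
  dimer_u a b x n.+1 = (a * dimer_u a b x n + x * dimer_v a b x n.+1) / b.
Proof. by rewrite /dimer_u /dimer_v /=; case: (dimer a b x n). Qed.

(** * The recursion over one unit cell *)

Section Dimer.
Variables (R : realFieldType) (a b x : R).
Hypotheses (a_gt0 : 0 < a) (b_gt0 : 0 < b).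
Let u := dimer_u a b x.
Let v := dimer_v a b x.
Let t := cell_trace a b x.
Let a_neq0 : a != 0. Proof. exact: lt0r_neq0. Qed.
Let b_neq0 : b != 0. Proof. by rewrite lt0r_neq0. Qed.

Lemma dimer_u_rec n : u n.+2 = t * u n.+1 - u n.
Proof.
rewrite /u /t /cell_trace !(dimer_uS, dimer_vS) -/u.
by field; rewrite a_neq0 b_neq0.
Qed.

Lemma dimer_v_rec n : v n.+2 = t * v n.+1 - v n.
Proof.
rewrite /v /t /cell_trace !(dimer_uS, dimer_vS).
by field; rewrite a_neq0 b_neq0.
Qed.

Lemma dimer_v1 : v 1%N = (b - x) / a.
Proof. by rewrite /v dimer_vS /dimer_u /dimer_v /= !mulr1. Qed.

Lemma dimer_u1 : u 1%N = (a ^+ 2 + x * b - x ^+ 2) / (a * b).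
Proof.
by rewrite /u dimer_uS dimer_vS /dimer_u /dimer_v /=; field; rewrite a_neq0 b_neq0.
Qed.

Lemma dimer_sum1 : u 1%N + v 1%N = t.
Proof. by rewrite dimer_u1 dimer_v1 /t /cell_trace; field; rewrite a_neq0 b_neq0. Qed.

Lemma dimer_prod1 : u 1%N * v 1%N = 1 + x * ((b - x) ^+ 2 - a ^+ 2) / (a ^+ 2 * b).
Proof. by rewrite dimer_u1 dimer_v1; field; rewrite a_neq0 b_neq0. Qed.

Lemma dimer_sum_ge0 n : 2 <= t -> 0 <= u n + v n.
Proof.
move=> t2; apply: (@rec2_ge0 _ (fun n => u n + v n) t) => //= [k|].
  by rewrite dimer_u_rec dimer_v_rec; ring.
by rewrite dimer_sum1; apply/andP; split; rewrite /u /v /dimer_u /dimer_v /=; lra.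
Qed.

(** Indeed t - 2 = ((a - b) ^ 2 - x ^ 2) / (a b). *)
Lemma cell_trace_gt2 : `|x| < `|a - b| -> 2 < t.
Proof.
move=> xgap; have : x ^+ 2 < (a - b) ^+ 2 by rewrite -(real_normK (num_real x)) -(real_normK (num_real (a - b))) ltr_pXn2r ?nnegrE.
rewrite /t /cell_trace ltr_pdivlMr ?mulr_gt0 //; nra.
Qed.

End Dimer.

(** Since (p - z) (p - 1/z) = 1 - p q >= 0, p is not strictly between the roots 1/z and z, and p is
    at least their mean. *)
Lemma root_dominates (R : realFieldType) (z p q : R) :
  1 < z -> p + q = z + z^-1 -> p * q <= 1 -> q <= p -> z <= p.
Proof.
move=> z1 sum prod qp.
have zi : z^-1 < 1 by rewrite invf_lt1 // (lt_trans ltr01).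
have ze : z * z^-1 = 1 by rewrite divff // gt_eqF // (lt_trans ltr01).
rewrite leNgt; apply/negP => pz.
have : p * (z + z^-1 - p) <= 1 by rewrite -sum addrAC subrr add0r.
nra.
Qed.

(** * Uniqueness of the mode in the gap *)

(** Discrete Green identity: the sum is the inner product of the two modes over one half of the
    chain, centre excluded. *)
Lemma dimer_wronskian (R : realFieldType) (a b x y : R) m : 0 < a -> 0 < b ->
  b * (dimer_v a b x m * dimer_u a b y m - dimer_v a b y m * dimer_u a b x m)
  = (y - x) * \sum_(n < m) (dimer_u a b x n * dimer_u a b y n
                            + dimer_v a b x n.+1 * dimer_v a b y n.+1).
Proof.
move=> a0 b0; have [an bn] := (lt0r_neq0 a0, lt0r_neq0 b0).
elim: m => [|m IHm].
  by rewrite big_ord0 mulr0 /dimer_u /dimer_v /= subrr mulr0.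
rewrite big_ord_recr /= [RHS]mulrDr -IHm !dimer_uS !dimer_vS.
by field; rewrite an bn.
Qed.

(** Regrouping pairs u n with v n instead of v (n+1); this leaves the first u term, equal to 1, and
    the last v term. *)
Lemma dimer_inner_ge (R : realFieldType) (a b x y : R) m :
  (forall n, 0 <= dimer_u a b x n * dimer_u a b y n
                  + dimer_v a b x n * dimer_v a b y n) ->
  1 + dimer_v a b x m.+1 * dimer_v a b y m.+1 <=
  \sum_(n < m.+1) (dimer_u a b x n * dimer_u a b y n
                   + dimer_v a b x n.+1 * dimer_v a b y n.+1).
Proof.
move=> uv_ge0; elim: m => [|m IHm].
  by rewrite big_ord1 /= {1}/dimer_u {1}/dimer_u /= mul1r lexx.
rewrite big_ord_recr /=; have := uv_ge0 m.+1; lra.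
Qed.

(** Being polynomial in x, both sequences are accessible to the intermediate value theorem of a real
    closed field. *)
Lemma dimer_poly (R : fieldType) (a b : R) n :
  exists p q : {poly R}, forall x, p.[x] = dimer_u a b x n /\ q.[x] = dimer_v a b x n.
Proof.
elim: n => [|n [p [q pq]]]; first by exists 1, 1 => x; rewrite !hornerE.
exists (b^-1 *: (a *: p + 'X * (a^-1 *: (b *: q - 'X * p)))),
       (a^-1 *: (b *: q - 'X * p)) => x.
have [px qx] := pq x.
rewrite dimer_uS !dimer_vS !(hornerZ, hornerD, hornerN, hornerM, hornerX) px qx.
by rewrite !(mulrC _^-1).
Qed.

Lemma mulr_ge_norm (R : realDomainType) (p p' q q' : R) :
  `|q| <= p -> `|q'| <= p' -> 0 <= p * p' + q * q'.
Proof.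
rewrite !ler_norml => /andP[? ?] /andP[? ?]; nra.
Qed.

(** * Domination by u when the end coupling is the stronger one *)

Section StrongEnd.
Variables (R : realFieldType) (a b x : R).
Hypotheses (b_gt0 : 0 < b) (b_lt_a : b < a) (xgap : `|x| < a - b).
Let a_gt0 : 0 < a. Proof. exact: lt_trans b_lt_a. Qed.
Let shift_lt : (b - x) ^+ 2 < a ^+ 2.
Proof.
move: xgap; rewrite ltr_norml => /andP[? ?].
have [a0 b0] := (a_gt0, b_gt0).
rewrite -subr_gt0 subr_sqr mulr_gt0 //; lra.
Qed.

Let t_gt2 : 2 < cell_trace a b x.
Proof. by apply: cell_trace_gt2; rewrite ?(ger0_norm (x := a - b)) ?subr_ge0 ?ltW. Qed.

Lemma strong_end_v1_le_u1 : dimer_v a b x 1 <= dimer_u a b x 1.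
Proof.
rewrite -subr_ge0 dimer_u1 // dimer_v1.
rewrite (_ : _ - _ = (a ^+ 2 - (b - x) ^+ 2) / (a * b)).
  by rewrite divr_ge0 ?mulr_ge0 ?ltW ?subr_gt0.
by field; rewrite !lt0r_neq0.
Qed.

(** Both u + v and u - v satisfy the recursion with nonnegative, nondecreasing initial values. *)
Lemma strong_end_dominated n :
  1 <= dimer_u a b x n /\ `|dimer_v a b x n| <= dimer_u a b x n.
Proof.
have u_rec := @dimer_u_rec _ a b x a_gt0 b_gt0.
have v_rec := @dimer_v_rec _ a b x a_gt0 b_gt0.
have sum1 := @dimer_sum1 _ a b x a_gt0 b_gt0.
have sum_ge0 := @dimer_sum_ge0 _ a b x a_gt0 b_gt0 n (ltW t_gt2).
have vu1 := strong_end_v1_le_u1.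
have dif_ge0 : 0 <= dimer_u a b x n - dimer_v a b x n.
  apply: (@rec2_ge0 _ (fun n => dimer_u a b x n - dimer_v a b x n) _ _ (ltW t_gt2)).
    by move=> k; rewrite u_rec v_rec; ring.
  by rewrite /dimer_u /dimer_v /= subrr lexx subr_ge0.
split; last by rewrite ler_norml; lra.
elim: n {sum_ge0 dif_ge0} => // n IHn; apply: le_trans IHn _.
(* This follows from u 1 + v 1 = t > 2 and v 1 <= u 1. *)
have u01 : 0 <= dimer_u a b x 0 <= dimer_u a b x 1.
  by rewrite {1 2}/dimer_u /= ler01; move: t_gt2; lra.
by case/andP: (rec2_nondecreasing u_rec (ltW t_gt2) u01 n).
Qed.

(** For x >= 0 the product u 1 * v 1 is at most 1, because |b - x| < a. *)
Lemma strong_end_growth z : 0 <= x -> 1 < z -> cell_trace a b x = z + z^-1 ->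
  z <= dimer_u a b x 1.
Proof.
move=> x0 z1 tz; apply: root_dominates z1 _ _ strong_end_v1_le_u1.
  by rewrite dimer_sum1.
rewrite dimer_prod1 // gerDl pmulr_lle0 ?invr_gt0 ?mulr_gt0 ?exprn_gt0 //.
by move: shift_lt; nra.
Qed.
End StrongEnd.

(** * Domination by v when the end coupling is the weaker one *)

Section WeakEnd.
Variables (R : realFieldType) (a b x : R).
Hypotheses (a_gt0 : 0 < a) (a_lt_b : a < b) (xgap : `|x| < b - a).
Let b_gt0 : 0 < b. Proof. exact: lt_trans a_lt_b. Qed.
Let shift_gt : a ^+ 2 < (b - x) ^+ 2.
Proof.
move: xgap; rewrite ltr_norml => /andP[? ?].
have [a0 b0] := (a_gt0, b_gt0).
rewrite -subr_gt0 subr_sqr mulr_gt0 //; lra.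
Qed.

Let t_gt2 : 2 < cell_trace a b x.
Proof.
by apply: cell_trace_gt2; rewrite // distrC (ger0_norm (x := b - a)) ?subr_ge0 ?ltW.
Qed.

Lemma weak_end_u1_le_v1 : dimer_u a b x 1 <= dimer_v a b x 1.
Proof.
rewrite -subr_ge0 dimer_u1 // dimer_v1.
rewrite (_ : _ - _ = ((b - x) ^+ 2 - a ^+ 2) / (a * b)).
  by rewrite divr_ge0 ?mulr_ge0 ?ltW ?subr_gt0.
by field; rewrite !lt0r_neq0.
Qed.

Lemma weak_end_dominated n :
  1 <= dimer_v a b x n /\ `|dimer_u a b x n| <= dimer_v a b x n.
Proof.
have u_rec := @dimer_u_rec _ a b x a_gt0 b_gt0.
have v_rec := @dimer_v_rec _ a b x a_gt0 b_gt0.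
have sum1 := @dimer_sum1 _ a b x a_gt0 b_gt0.
have sum_ge0 := @dimer_sum_ge0 _ a b x a_gt0 b_gt0 n (ltW t_gt2).
have uv1 := weak_end_u1_le_v1.
have dif_ge0 : 0 <= dimer_v a b x n - dimer_u a b x n.
  apply: (@rec2_ge0 _ (fun n => dimer_v a b x n - dimer_u a b x n) _ _ (ltW t_gt2)).
    by move=> k; rewrite u_rec v_rec; ring.
  by rewrite /dimer_u /dimer_v /= subrr lexx subr_ge0.
split; last by rewrite ler_norml; lra.
elim: n {sum_ge0 dif_ge0} => // n IHn; apply: le_trans IHn _.
have v01 : 0 <= dimer_v a b x 0 <= dimer_v a b x 1.
  by rewrite {1 2}/dimer_v /= ler01; move: t_gt2; lra.
by case/andP: (rec2_nondecreasing v_rec (ltW t_gt2) v01 n).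
Qed.

(** Now |b - x| > a, so that u 1 * v 1 is at most 1 for x <= 0. *)
Lemma weak_end_growth z : x <= 0 -> 1 < z -> cell_trace a b x = z + z^-1 ->
  z <= dimer_v a b x 1.
Proof.
move=> x0 z1 tz; apply: root_dominates z1 _ _ weak_end_u1_le_v1.
  by rewrite addrC dimer_sum1.
rewrite mulrC dimer_prod1 // gerDl pmulr_lle0 ?invr_gt0 ?mulr_gt0 ?exprn_gt0 //.
by move: shift_gt; nra.
Qed.
End WeakEnd.

(** The equation at the central resonator for a symmetric mode, both of whose central neighbours
    carry v m up to sign; an antisymmetric mode must instead vanish at the centre. *)
Definition centre_even (R : fieldType) (a b : R) m x :=
  2 * b * dimer_v a b x m = (b - a + x) * dimer_u a b x m.
Definition centre_odd (R : fieldType) (a b : R) m x := dimer_u a b x m = 0.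

(** Even modes for distinct x would be orthogonal, but domination makes their inner product
    positive. *)
Lemma strong_end_even_unique (R : realFieldType) (a b x y : R) m :
  0 < b -> b < a -> `|x| < a - b -> `|y| < a - b -> (0 < m)%N ->
  centre_even a b m x -> centre_even a b m y -> x = y.
Proof.
move=> b0 ba xgap ygap; case: m => // m _ Ex Ey.
have a0 : 0 < a by exact: lt_trans ba.
have [ux vx] := strong_end_dominated b0 ba xgap m.+1.
have [uy vy] := strong_end_dominated b0 ba ygap m.+1.
have := dimer_wronskian x y m.+1 a0 b0.
have := @dimer_inner_ge _ a b x y m.
set S := \sum_(n < _) _ => S_ge W.
have {}S_ge : 1 + dimer_v a b x m.+1 * dimer_v a b y m.+1 <= S.
  by apply: S_ge => n; apply: mulr_ge_norm;
    [case: (strong_end_dominated b0 ba xgap n)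
    |case: (strong_end_dominated b0 ba ygap n)].
(* As b - a + w < 0 in the gap, v is nonpositive next to the centre, so the product of two such
   values in [S_ge] is nonnegative. *)
have v_neg w : `|w| < a - b -> 1 <= dimer_u a b w m.+1 -> centre_even a b m.+1 w ->
    dimer_v a b w m.+1 <= 0.
  rewrite ltr_norml /centre_even => /andP[? ?] ? ?.
  rewrite -(pmulr_rle0 (dimer_v a b w m.+1) (x := 2 * b)); nra.
have vx0 := v_neg _ xgap ux Ex; have vy0 := v_neg _ ygap uy Ey.
move: Ex Ey; rewrite /centre_even => Ex Ey.
(* The second factor is the inner product over the whole chain: the centre once and the half-chain
   sum S twice. *)
have : (x - y) * (dimer_u a b x m.+1 * dimer_u a b y m.+1 + 2 * S) = 0.
  transitivity ((x - y) * (dimer_u a b x m.+1 * dimer_u a b y m.+1)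
                - 2 * ((y - x) * S)); first by ring.
  rewrite -W; transitivity ((x - y) * (dimer_u a b x m.+1 * dimer_u a b y m.+1)
    - 2 * b * dimer_v a b x m.+1 * dimer_u a b y m.+1
    + 2 * b * dimer_v a b y m.+1 * dimer_u a b x m.+1); first by ring.
  by rewrite Ex Ey; ring.
move/eqP; rewrite mulf_eq0 subr_eq0 => /orP[/eqP //|].
by rewrite gt_eqF //; nra.
Qed.

(** Both modes vanish at the centre, so the Wronskian is 0, whereas the half-chain inner product is
    positive. *)
Lemma weak_end_odd_unique (R : realFieldType) (a b x y : R) m :
  0 < a -> a < b -> `|x| < b - a -> `|y| < b - a -> (0 < m)%N ->
  centre_odd a b m x -> centre_odd a b m y -> x = y.
Proof.
move=> a0 ab xgap ygap; case: m => // m _ Ex Ey.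
have b0 : 0 < b by exact: lt_trans ab.
have [vx ux] := weak_end_dominated a0 ab xgap m.+1.
have [vy uy] := weak_end_dominated a0 ab ygap m.+1.
have := dimer_wronskian x y m.+1 a0 b0.
rewrite Ex Ey !mulr0 subrr mulr0 => /esym/eqP.
rewrite mulf_eq0 subr_eq0 => /orP[/eqP //|].
have := @dimer_inner_ge _ a b x y m.
set S := \sum_(n < _) _ => S_ge.
have {}S_ge : 1 + dimer_v a b x m.+1 * dimer_v a b y m.+1 <= S.
  by apply: S_ge => n; rewrite addrC; apply: mulr_ge_norm;
    [case: (weak_end_dominated a0 ab xgap n)
    |case: (weak_end_dominated a0 ab ygap n)].
by rewrite gt_eqF //; nra.
Qed.

(** In the gap 0 < b - a + x < 2 b, so |u m| <= v m and v m >= 1 make the left side strictly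
    larger. *)
Lemma weak_end_no_even (R : realFieldType) (a b x : R) m :
  0 < a -> a < b -> `|x| < b - a -> ~ centre_even a b m x.
Proof.
move=> a0 ab xgap.
have [vx] := weak_end_dominated a0 ab xgap m.
move: xgap; rewrite /centre_even !ler_norml ltr_norml => /andP[? ?] /andP[? ?] ?.
nra.
Qed.

Lemma weak_end_odd_exists (R : rcfType) (a b : R) m :
  0 < a -> a < b -> a < 2 * m%:R * (b - a) ->
  exists x, [/\ a - b < x, x <= 0 & centre_odd a b m x].
Proof.
move=> a0 ab m_large; have b0 : 0 < b by exact: lt_trans ab.
have [p [_ /all_and2[pE _]]] := dimer_poly a b m.
(* At the band edge the trace is 2, the recursion has the double root 1, and u is affine in n. *)
have edge n : dimer_u a b (a - b) n = 1 - 2 * n%:R * (b - a) / a.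
  suff: dimer_u a b (a - b) n = 1 - 2 * n%:R * (b - a) / a /\
        dimer_u a b (a - b) n.+1 = 1 - 2 * n.+1%:R * (b - a) / a by case.
  elim: n => [|n [IH0 IH1]].
    by split; rewrite ?dimer_u1 ?{1}/dimer_u //=; field; rewrite ?lt0r_neq0.
  split=> //; rewrite dimer_u_rec // IH0 IH1 /cell_trace -!natr1.
  by field; rewrite !lt0r_neq0.
(* At x = 0 the sequences decouple and u n = (a / b) ^ n. *)
have mid n : 0 <= dimer_u a b 0 n.
  elim: n => [|n IHn]; first exact: ler01.
  by rewrite dimer_uS mul0r addr0 mulr_ge0 ?invr_ge0 ?mulr_ge0 ?(ltW a0) ?(ltW b0).
have edge_lt0 : p.[a - b] < 0.
  by rewrite pE edge subr_lt0 ltr_pdivlMr // mul1r.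
have le_ab : a - b <= 0 by rewrite subr_le0 ltW.
have [|x /andP[ax x0] rx] := poly_ivt (p := p) le_ab.
  by rewrite (ltW edge_lt0) pE mid.
exists x; split=> //; last by rewrite /centre_odd -pE; apply/rootP.
rewrite lt_neqAle ax andbT; apply/eqP => xE.
by move: edge_lt0; rewrite xE; move/rootP: rx => ->; rewrite ltxx.
Qed.

(** * The even mode *)

(* The positive root of x ^ 2 + (a + b) x = 2 (a - b) ^ 2. *)
Definition limit_shift (R : rcfType) (a b : R) : R :=
  (Num.sqrt ((a + b) ^+ 2 + 8 * (a - b) ^+ 2) - (a + b)) / 2.

Lemma limit_shift_root (R : rcfType) (a b : R) :
  limit_shift a b ^+ 2 + (a + b) * limit_shift a b = 2 * (a - b) ^+ 2.
Proof.
rewrite /limit_shift.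
have : Num.sqrt ((a + b) ^+ 2 + 8 * (a - b) ^+ 2) ^+ 2 = (a + b) ^+ 2 + 8 * (a - b) ^+ 2.
  by rewrite sqr_sqrtr // addr_ge0 ?sqr_ge0 // mulr_ge0 ?sqr_ge0.
set w := Num.sqrt _ => w2; lra.
Qed.

(** At x = a - b the quadratic x ^ 2 + (a + b) x exceeds 2 (a - b) ^ 2 by 2 b (a - b), so the
    positive root lies below a - b. *)
Lemma limit_shift_gap (R : rcfType) (a b : R) : 0 < b -> b < a ->
  0 < limit_shift a b < a - b.
Proof.
move=> b0 ba; have D0 : 0 < a - b by rewrite subr_gt0.
have W0 : 0 <= (a + b) ^+ 2 + 8 * (a - b) ^+ 2.
  by rewrite addr_ge0 ?sqr_ge0 // mulr_ge0 ?sqr_ge0.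
have sq0 := sqrtr_ge0 ((a + b) ^+ 2 + 8 * (a - b) ^+ 2).
apply/andP; split.
  rewrite divr_gt0 // subr_gt0 -(ltr_pXn2r (n := 2)) ?nnegrE ?sqr_sqrtr //; first nra.
  lra.
rewrite ltr_pdivrMr // ltrBlDr -(ltr_pXn2r (n := 2)) ?nnegrE ?sqr_sqrtr //; first nra.
lra.
Qed.

(** For t > 2, the root greater than 1 of z + 1/z = t; with t = [cell_trace] it is exp (beta L). *)
Definition multiplier (R : rcfType) (t : R) : R := (t + Num.sqrt (t ^+ 2 - 4)) / 2.

Lemma multiplier_gt1 (R : rcfType) (t : R) : 2 < t -> 1 < multiplier t.
Proof.
by move=> t2; rewrite ltr_pdivlMr // mul1r ltr_wpDr // sqrtr_ge0.
Qed.

Lemma multiplierE (R : rcfType) (t : R) : 2 < t ->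
  t = multiplier t + (multiplier t)^-1.
Proof.
move=> t2; have z1 := multiplier_gt1 t2.
have z0 : multiplier t != 0 by rewrite gt_eqF // (lt_trans ltr01).
apply: (mulIf z0); rewrite mulrDl mulVf //; apply/eqP; rewrite -subr_eq0 /multiplier.
have : Num.sqrt (t ^+ 2 - 4) ^+ 2 = t ^+ 2 - 4 by rewrite sqr_sqrtr //; nra.
by set w := Num.sqrt _ => w2; apply/eqP; lra.
Qed.

(** The difference of the two sums is (z' - z) (1 - 1/(z z')), with positive second factor. *)
Lemma multiplier_mono (R : realFieldType) (z z' : R) :
  1 < z -> 1 < z' -> z + z^-1 <= z' + z'^-1 -> z <= z'.
Proof.
move=> z1 z'1; have [z0 z'0] : 0 < z /\ 0 < z' by split; lra.
have zi : z^-1 * z'^-1 < 1 by rewrite -invfM invf_lt1 ?mulr_gt0 //; nra.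
have -> : (z + z^-1 <= z' + z'^-1) = (0 <= (z' - z) * (1 - z^-1 * z'^-1)).
  by rewrite -subr_ge0; congr (0 <= _); field; rewrite !lt0r_neq0.
by rewrite pmulr_lge0 ?subr_ge0 // subr_gt0.
Qed.

Lemma multiplier_unique (R : realFieldType) (z z' : R) :
  1 < z -> 1 < z' -> z + z^-1 = z' + z'^-1 -> z = z'.
Proof.
by move=> z1 z'1 zz'; apply/le_anti/andP; split; apply: multiplier_mono => //; rewrite zz'.
Qed.

(** Same factorisation, with 1 - 1/(z z') >= 1 - 1/z. *)
Lemma multiplier_lipschitz (R : realFieldType) (z z' : R) : 1 < z -> 1 < z' ->
  `|z' - z| * (1 - z^-1) <= `|(z' + z'^-1) - (z + z^-1)|.
Proof.
move=> z1 z'1; have [z0 z'0] : 0 < z /\ 0 < z' by split; lra.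
rewrite (_ : z' + z'^-1 - (z + z^-1) = (z' - z) * (1 - z^-1 * z'^-1)); last first.
  by field; rewrite !lt0r_neq0.
rewrite normrM ler_wpM2l // ger0_norm.
  by rewrite lerD2l lerN2 ler_piMr ?invr_ge0 ?invf_le1 ?ltW.
by rewrite subr_ge0 -invfM invf_le1 ?mulr_gt0 // mulr_ege1 ?ltW.
Qed.

(* An even mode, normalised to 1 at the central resonator, has the value
   - centre_ratio two sites away; on the infinite chain this must be the decaying
   multiplier. *)
Definition centre_ratio (R : fieldType) (a b x : R) : R :=
  (2 * b ^+ 2 + (a - b) * x - x ^+ 2) / (2 * a * b).

(** Eliminating v by the recursion turns the even condition, for nonzero x, into u n =
    [centre_ratio] * u (n+1). *)
Lemma centre_evenE (R : realFieldType) (a b x : R) n : 0 < a -> 0 < b ->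
  x * ((b - a + x) * dimer_u a b x n.+1 - 2 * b * dimer_v a b x n.+1) =
  2 * a * b * (dimer_u a b x n - centre_ratio a b x * dimer_u a b x n.+1).
Proof.
move=> a0 b0; have [an bn] := (lt0r_neq0 a0, lt0r_neq0 b0).
by rewrite /centre_ratio dimer_uS; field; rewrite an bn.
Qed.

(** With r for the ratio, the left side is 1/z times the characteristic polynomial r ^ 2 - t r + 1,
    up to (2 a b) ^ 2. The quadratic factor on the right vanishes at [limit_shift]. *)
Lemma centre_ratio_defect (R : realFieldType) (a b x z : R) : 0 < a -> 0 < b ->
  z != 0 -> cell_trace a b x = z + z^-1 ->
  (z^-1 - centre_ratio a b x) * (1 - z^-1 * centre_ratio a b x) * (2 * a * b) ^+ 2 =
  z^-1 * (x * (a + b - x) * (x ^+ 2 + (a + b) * x - 2 * (a - b) ^+ 2)).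
Proof.
move=> a0 b0 z0 tz; have [an bn] := (lt0r_neq0 a0, lt0r_neq0 b0).
transitivity (z^-1 * (1 - centre_ratio a b x * (z + z^-1) + centre_ratio a b x ^+ 2)
              * (2 * a * b) ^+ 2); first by field.
by rewrite -tz /cell_trace /centre_ratio; field; rewrite an bn z0.
Qed.

(** The last hypothesis gives (a - b) x - x ^ 2 <= 2 a x - 2 (a - b) ^ 2 < 2 b (a - b). *)
Lemma centre_ratio_lt1 (R : realFieldType) (a b x : R) : 0 < b -> b < a -> x < a - b ->
  2 * (a - b) ^+ 2 <= x ^+ 2 + (a + b) * x -> centre_ratio a b x < 1.
Proof.
move=> b0 ba xD x_ge; rewrite ltr_pdivrMr ?mulr_gt0 // ?(lt_trans b0) //; nra.
Qed.

Lemma centre_ratio_gt0 (R : realFieldType) (a b x : R) : 0 < b -> b < a ->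
  0 < x -> x < a - b -> 0 < centre_ratio a b x.
Proof.
move=> b0 ba x0 xD; have a0 : 0 < a by exact: lt_trans ba.
have := mulr_gt0 b0 b0; have : 0 < x * (a - b - x) by rewrite mulr_gt0 ?subr_gt0.
by move=> ? ?; rewrite divr_gt0 ?mulr_gt0 //; lra.
Qed.

(** In [centre_ratio_defect] the right side is nonnegative and, with r for the ratio, 1 - r / z is
    positive. *)
Lemma centre_ratio_le (R : realFieldType) (a b x z : R) : 0 < b -> b < a ->
  0 < x -> x < a - b -> 1 < z -> cell_trace a b x = z + z^-1 ->
  2 * (a - b) ^+ 2 <= x ^+ 2 + (a + b) * x -> centre_ratio a b x <= z^-1.
Proof.
move=> b0 ba x0 xD z1 tz x_ge; have a0 : 0 < a by exact: lt_trans ba.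
have z0 : 0 < z by lra.
have zi0 : 0 < z^-1 by rewrite invr_gt0.
have zi1 : z^-1 < 1 by rewrite invf_lt1.
have r1 := centre_ratio_lt1 b0 ba xD x_ge.
have r0 := centre_ratio_gt0 b0 ba x0 xD.
rewrite -subr_ge0 -(pmulr_lge0 _ (x := 1 - z^-1 * centre_ratio a b x)); last by nra.
rewrite -(pmulr_lge0 _ (x := (2 * a * b) ^+ 2)) ?exprn_gt0 ?mulr_gt0 //.
rewrite (centre_ratio_defect a0 b0 (lt0r_neq0 z0) tz).
by rewrite !mulr_ge0 // ?(ltW zi0) ?(ltW x0) ?subr_ge0 //; lra.
Qed.

(** The even condition is the equation of the infinite chain, ratio equal to 1/z, weighted by u
    (n+1), up to a correction with factor z ^ (- (n+1)) due to the end of the chain. *)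
Lemma even_excess (R : realFieldType) (a b x z : R) n : 0 < b -> b < a ->
  1 < z -> cell_trace a b x = z + z^-1 ->
  x * ((b - a + x) * dimer_u a b x n.+1 - 2 * b * dimer_v a b x n.+1) =
  2 * a * b * ((z^-1 - centre_ratio a b x) * dimer_u a b x n.+1
               - z^-1 ^+ n.+1 * (dimer_u a b x 1 - z)).
Proof.
move=> b0 ba z1 tz; have a0 : 0 < a by exact: lt_trans ba.
have zn0 : z != 0 by rewrite gt_eqF //; lra.
rewrite centre_evenE //; congr (_ * _).
have u_rec k : dimer_u a b x k.+2 = (z + z^-1) * dimer_u a b x k.+1 - dimer_u a b x k.
  by rewrite -tz dimer_u_rec.
have := rec2_defect zn0 u_rec n; rewrite [dimer_u a b x 0]/(1 : R) mulr1 => defect.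
rewrite exprS -mulrA -defect; field; exact: zn0.
Qed.

(** The excess in the even condition changes sign between the limit shift and y; the last hypothesis
    says that at y the end correction does not outweigh the main term. *)
Lemma strong_end_even_exists (R : rcfType) (a b y z : R) n : 0 < b -> b < a ->
  limit_shift a b < y -> y < a - b -> 1 < z -> cell_trace a b y = z + z^-1 ->
  z^-1 ^+ n.+1 * (dimer_u a b y 1 - z) <= z^-1 - centre_ratio a b y ->
  exists x, limit_shift a b <= x <= y /\ centre_even a b n.+1 x.
Proof.
move=> b0 ba xiy yD z1 tz small; have a0 : 0 < a by exact: lt_trans ba.
have /andP[xi0 xiD] := limit_shift_gap b0 ba.
have xiE := limit_shift_root a b.
move: (limit_shift a b) xiy xi0 xiD xiE => xi xiy xi0 xiD xiE.
have [p [q /all_and2[pE qE]]] := dimer_poly a b n.+1.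
pose f := ((b - a)%:P + 'X) * p - (2 * b)%:P * q.
have fE x : f.[x] = (b - a + x) * dimer_u a b x n.+1 - 2 * b * dimer_v a b x n.+1.
  by rewrite !(hornerD, hornerN, hornerM, hornerC, hornerX) pE qE.
have gap x : 0 < x -> x < a - b -> `|x| < a - b by move=> x0 ?; rewrite gtr0_norm.
have [|x xint rx] := poly_ivt (p := f) (ltW xiy); last first.
  exists x; split=> //; apply/eqP; rewrite eq_sym -subr_eq0 -fE; exact: rx.
have y0 : 0 < y by exact: lt_trans xiy.
apply/andP; split; last first.
  rewrite fE -(pmulr_rge0 _ y0) (even_excess n b0 ba z1 tz).
  rewrite mulr_ge0 ?mulr_ge0 ?(ltW a0) ?(ltW b0) // subr_ge0.
  apply: le_trans small _; rewrite ler_peMr //.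
    rewrite subr_ge0; apply: (centre_ratio_le b0 ba y0 yD z1 tz).
    have : 0 <= (y - xi) * (y + xi + (a + b)) by rewrite mulr_ge0 //; lra.
    lra.
  by case: (strong_end_dominated b0 ba (gap _ y0 yD) n.+1).
have t2 : 2 < cell_trace a b xi.
  by apply: cell_trace_gt2; rewrite // !gtr0_norm // subr_gt0.
have [w1 tw] := (multiplier_gt1 t2, multiplierE t2).
set w := multiplier _ in w1 tw.
have w0 : 0 < w by lra.
rewrite fE -(pmulr_rle0 _ xi0) (even_excess n b0 ba w1 tw).
have rho_le : centre_ratio a b xi <= w^-1.
  by apply: (centre_ratio_le _ _ _ _ w1 tw); rewrite // xiE.
have rho1 : centre_ratio a b xi < 1.
  by apply: centre_ratio_lt1; rewrite // xiE.
have rho0 := centre_ratio_gt0 b0 ba xi0 xiD.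
(* At the limit shift the quadratic factor vanishes, which forces the ratio to be 1/w. Only the end
   correction is left, and its sign is known from u 1 >= w. *)
have /eqP := centre_ratio_defect a0 b0 (lt0r_neq0 w0) tw.
rewrite xiE subrr !mulr0 mulf_eq0 mulf_eq0 !subr_eq0 => /orP[/orP[/eqP wE|/eqP wE]|].
- rewrite wE subrr mul0r sub0r mulrN oppr_le0 mulr_ge0 ?mulr_ge0 ?exprn_ge0 ?(ltW a0) ?(ltW b0) ?(ltW rho0) //.
  rewrite subr_ge0.
  exact: (strong_end_growth b0 ba (gap _ xi0 xiD) (ltW xi0) w1 tw).
- have wi1 : w^-1 < 1 by rewrite invf_lt1.
  have wi0 : 0 <= w^-1 by rewrite invr_ge0 ltW.
  by have := mulr_ilt1 wi0 (ltW rho0) wi1 rho1; rewrite -wE ltxx.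
- by rewrite gt_eqF // exprn_gt0 ?mulr_gt0.
Qed.

(** At a root, u (n+1) >= z ^ (n+1) makes 1/z minus the ratio exponentially small by [even_excess];
    [centre_ratio_defect] converts this into a bound on x. *)
Lemma even_root_estimate (R : rcfType) (a b x z : R) n : 0 < b -> b < a ->
  limit_shift a b <= x -> x < a - b -> 1 < z -> cell_trace a b x = z + z^-1 ->
  centre_even a b n.+1 x ->
  x - limit_shift a b <= 4 * a ^+ 2 * b / ((a + b) * limit_shift a b) * z^-1 ^+ n.+1.
Proof.
move=> b0 ba xix xD z1 tz root; have a0 : 0 < a by exact: lt_trans ba.
have /andP[xi0 xiD] := limit_shift_gap b0 ba.
have xiE := limit_shift_root a b.
move: (limit_shift a b) xix xi0 xiD xiE => xi xix xi0 xiD xiE.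
have x0 : 0 < x by exact: lt_le_trans xix.
have z0 : 0 < z by lra.
have xgap : `|x| < a - b by rewrite gtr0_norm.
have r0 : 0 < z^-1 by rewrite invr_gt0.
have r1 : z^-1 < 1 by rewrite invf_lt1.
have rz : z^-1 * z = 1 by rewrite mulVf // lt0r_neq0.
have u_rec k : dimer_u a b x k.+2 = (z + z^-1) * dimer_u a b x k.+1 - dimer_u a b x k.
  by rewrite -tz dimer_u_rec.
have u1 := strong_end_growth b0 ba xgap (ltW x0) z1 tz.
have u_ge : z ^+ n.+1 <= dimer_u a b x n.+1.
  have := @rec2_growth _ (dimer_u a b x) z z0 u_rec.
  by rewrite [dimer_u a b x 0]/(1 : R) mulr1 => /(_ u1 0%N n.+1); rewrite add0n mulr1.
(* Here u 1 - z = 1/z - v 1, with 1/z < 1 and v 1 >= -1. *)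
have u1_le : dimer_u a b x 1 - z <= 2.
  have := dimer_sum1 x a0 b0; rewrite tz dimer_v1 => sum1.
  have : (b - x) / a >= -1 by rewrite ler_pdivlMr //; lra.
  by move=> ?; lra.
have rho0 := centre_ratio_gt0 b0 ba x0 xD.
have := even_excess n b0 ba z1 tz; rewrite -root subrr mulr0 => /esym/eqP.
rewrite mulf_eq0 gt_eqF ?mulr_gt0 //= subr_eq0 => /eqP rho_eq.
set rho := centre_ratio a b x in rho0 rho_eq.
have rho_le : rho <= z^-1.
  rewrite -subr_ge0 -(pmulr_lge0 _ (x := dimer_u a b x n.+1)); last first.
    by apply: lt_le_trans u_ge; rewrite exprn_gt0.
  by rewrite rho_eq mulr_ge0 ?exprn_ge0 ?subr_ge0 // ltW.
have rn0 : 0 < z^-1 ^+ n.+1 by rewrite exprn_gt0.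
have zn0 : 0 < z ^+ n.+1 by rewrite exprn_gt0.
(* The argument yields 2 z ^ (- 2 (n+1)); it is weakened so as to keep one factor 1/z, which later
   cancels the one in [centre_ratio_defect]. *)
have rho_dist : z^-1 - rho <= 2 * (z^-1 * z^-1 ^+ n.+1).
  have : (z^-1 - rho) * z ^+ n.+1 <= 2 * z^-1 ^+ n.+1.
    apply: (@le_trans _ _ ((z^-1 - rho) * dimer_u a b x n.+1)).
      by rewrite ler_wpM2l ?subr_ge0.
    by rewrite rho_eq mulrC ler_wpM2r // ltW.
  rewrite -(ler_pM2r rn0) -mulrA -exprMn (mulrC z) rz expr1n mulr1 => /le_trans; apply.
  rewrite -mulrA ler_pM2l // ler_wpM2r ?(ltW rn0) // exprS ler_piMr ?(ltW r0) //.
  by rewrite exprn_ile1 // ltW.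
have defect := centre_ratio_defect a0 b0 (lt0r_neq0 z0) tz.
rewrite -/rho in defect.
have bound : (z^-1 - rho) * (1 - z^-1 * rho) <= 2 * (z^-1 * z^-1 ^+ n.+1).
  apply: le_trans rho_dist; rewrite ler_piMr ?subr_ge0 //.
  by rewrite gerBl mulr_ge0 // ltW.
have : z^-1 * (x * (a + b - x) * (x ^+ 2 + (a + b) * x - 2 * (a - b) ^+ 2)) <=
       z^-1 * (2 * z^-1 ^+ n.+1 * (2 * a * b) ^+ 2).
  rewrite -defect (_ : z^-1 * (_ * _) = 2 * (z^-1 * z^-1 ^+ n.+1) * (2 * a * b) ^+ 2).
    by apply: ler_wpM2r bound; rewrite ltW // exprn_gt0 // !mulr_gt0.
  by ring.
rewrite ler_pM2l // -xiE.
rewrite (_ : x ^+ 2 + _ - _ = (x - xi) * (x + xi + (a + b))); last by ring.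
set e := z^-1 ^+ _ => le_e.
(* The other factors are bounded below by x >= xi, a + b - x >= 2 b and x + xi + (a + b) >= a +
   b. *)
have lower : (x - xi) * ((a + b) * xi * (2 * b)) <= 2 * e * (2 * a * b) ^+ 2.
  apply: le_trans le_e.
  have -> : x * (a + b - x) * ((x - xi) * (x + xi + (a + b))) =
     (x - xi) * ((x + xi + (a + b)) * x * (a + b - x)) by ring.
  rewrite ler_wpM2l ?subr_ge0 //; apply: ler_pM; rewrite ?mulr_ge0 //; try lra.
  apply: ler_pM; lra.
rewrite -(ler_pM2r (x := (a + b) * xi * (2 * b))); last by rewrite !mulr_gt0 ?addr_gt0.
apply: le_trans lower _; rewrite le_eqVlt; apply/orP; left; apply/eqP.
by field; rewrite !lt0r_neq0 ?addr_gt0.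
Qed.

(** * From the capacitance matrix to the two halves of the chain *)

(** Each column of the matrix sums to zero, so it acts as a weighted discrete Laplacian with free
    ends. *)
Lemma capacitance_sum (R : realType) N (g U : nat -> R) (i : 'I_N) :
  \sum_(j < N) U j * capacitance N g j i =
  (if (0 < i)%N then (g i)^-1 * (U i - U i.-1) else 0)
  + (if (i.+1 < N)%N then (g i.+1)^-1 * (U i - U i.+1) else 0).
Proof.
pose d (k : nat) := (if (0 < k)%N then (g k)^-1 else 0)
                    + (if (k.+1 < N)%N then (g k.+1)^-1 else 0).
(* The guard 0 < i matters: for i = 0 the predecessor [i.-1] is i itself. *)
transitivity (\sum_(j < N) ((if j == i :> nat then U j * d j else 0)
   + (if (0 < i)%N then if j == i.-1 :> nat then - (U j * (g i)^-1) else 0 else 0)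
   + (if j == i.+1 :> nat then - (U j * (g i.+1)^-1) else 0))).
  apply: eq_bigr => j _; rewrite mxE -val_eqE /=.
  have [->|ji] := eqVneq (j : nat) (i : nat).
    have -> : (i == i.+1 :> nat) = false by lia.
    have -> : (if (0 < i)%N then if i == i.-1 :> nat then - (U i * (g i)^-1) else 0 else 0)
              = 0 by case: posnP => // i0; rewrite ifF //; lia.
    by rewrite !addr0.
  rewrite add0r; have [ij|ij] := eqVneq j.+1 (i : nat).
    have -> : (j == i.+1 :> nat) = false by lia.
    by rewrite -ij /= eqxx addr0 mulrN.
  rewrite (_ : (if (0 < i)%N then _ else _) = 0) ?add0r; last first.
    by case: posnP => // i0; case: eqP => //; lia.
  by rewrite eq_sym; case: eqP => [->|_]; rewrite ?mulrN ?mulr0.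
rewrite !big_split /= -!big_mkcond /=.
rewrite (big_ord1_eq _ (fun k => U k * d k)) ltn_ord.
rewrite (big_ord1_eq _ (fun k => - (U k * (g i.+1)^-1))).
rewrite (_ : \sum_(j < N | _) _ = if (0 < i)%N then - (U i.-1 * (g i)^-1) else 0); last first.
  case: posnP => i0; first by rewrite big_pred0.
  rewrite -big_mkcond (big_ord1_eq _ (fun k => - (U k * (g i)^-1))).
  by rewrite (leq_ltn_trans (leq_pred i)).
by rewrite /d; case: ifP => _; case: ifP => _; ring.
Qed.

(** Restores the alternating signs at site k from the end; [uphalf] sends the sites 2 n - 1 and 2 n
    to n. *)
Definition half_mode (R : fieldType) (a b x : R) (k : nat) : R :=
  (-1) ^+ uphalf k * (if odd k then dimer_v a b x (uphalf k) else dimer_u a b x (uphalf k)).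

Lemma half_mode_even (R : fieldType) (a b x : R) n :
  half_mode a b x n.*2 = (-1) ^+ n * dimer_u a b x n.
Proof. by rewrite /half_mode odd_double uphalf_double. Qed.

Lemma half_mode_odd (R : fieldType) (a b x : R) n :
  half_mode a b x n.*2.+1 = (-1) ^+ n.+1 * dimer_v a b x n.+1.
Proof. by rewrite /half_mode /= odd_double /= doubleK. Qed.

Lemma half_mode0 (R : fieldType) (a b x : R) : half_mode a b x 0 = 1.
Proof. by rewrite /half_mode mul1r. Qed.

(** The index k stands for the bond between the sites k - 1 and k counted from an end. *)
Definition coupling (R : fieldType) (a b : R) k := if odd k then a else b.

Lemma half_mode_end (R : realFieldType) (a b x : R) : 0 < a -> 0 < b ->
  a * (half_mode a b x 0 - half_mode a b x 1) = (a + b - x) * half_mode a b x 0.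
Proof.
move=> a0 b0; rewrite half_mode0 (half_mode_odd a b x 0) dimer_v1 //.
by field; rewrite lt0r_neq0.
Qed.

Lemma half_mode_bulk (R : realFieldType) (a b x : R) k : 0 < a -> 0 < b ->
  coupling a b k.+1 * (half_mode a b x k.+1 - half_mode a b x k)
  + coupling a b k.+2 * (half_mode a b x k.+1 - half_mode a b x k.+2)
  = (a + b - x) * half_mode a b x k.+1.
Proof.
move=> a0 b0; rewrite -[k]odd_double_half; move: (odd k) k./2 => [] n.
  rewrite /coupling add1n /= odd_double /= -doubleS.
  rewrite !half_mode_odd !half_mode_even [dimer_v _ _ _ n.+2]dimer_vS !exprS.
  by field; rewrite lt0r_neq0.
rewrite add0n /coupling /= odd_double /= -doubleS.
rewrite !half_mode_odd !half_mode_even dimer_uS !exprS.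
by field; rewrite lt0r_neq0.
Qed.

(** Two values and a three-term equation with nonzero g' determine the third value, so
    proportionality to a solution propagates. *)
Lemma three_term_step (R : fieldType) (g g' l c h h1 h2 p : R) : g' != 0 ->
  g * (h1 - h) + g' * (h1 - h2) = l * h1 ->
  g * (c * h1 - c * h) + g' * (c * h1 - p) = l * (c * h1) -> p = c * h2.
Proof.
move=> g'0 eh ep; apply: (mulfI g'0).
have -> : g' * p = g * (c * h1 - c * h) + g' * (c * h1) - l * (c * h1) by rewrite -ep; ring.
transitivity (c * (g * (h1 - h) + g' * h1 - l * h1)); first by ring.
by rewrite -eh; ring.
Qed.

Section Chain.
Variables (R : realType) (s1 s2 : R).
Let a := s1^-1.
Let b := s2^-1.
Lemma spacing_left m k : (k <= 2 * m)%N -> (spacing s1 s2 m k)^-1 = coupling a b k.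
Proof. by move=> km; rewrite /spacing km /coupling; case: odd. Qed.

(** The right half mirrors the left one: seen from the right end, this is the bond between the sites
    k and k + 1. *)
Lemma spacing_right m k : (k < 2 * m)%N ->
  (spacing s1 s2 m (4 * m - k))^-1 = coupling a b k.+1.
Proof.
move=> km; rewrite /spacing ifF; last by lia.
by rewrite oddB ?oddM /coupling /=; [case: odd | lia].
Qed.

(** Indexing by natural numbers lets neighbours be named directly; [inord] sends an index out of
    range to 0, and the guards of [eigenspace_chainP] exclude that case. *)
Definition row_fun m (u : 'rV[R]_(4 * m).+1) (k : nat) : R := u ord0 (inord k).

Lemma row_funE m (u : 'rV[R]_(4 * m).+1) (i : 'I_(4 * m).+1) : u ord0 i = row_fun u i.
Proof. by rewrite /row_fun inord_val. Qed.

Lemma eigenspace_chainP m (u : 'rV[R]_(4 * m).+1) (lambda : R) :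
  reflect (forall i, (i <= 4 * m)%N ->
     (if (0 < i)%N then (spacing s1 s2 m i)^-1 * (row_fun u i - row_fun u i.-1) else 0)
     + (if (i < 4 * m)%N then (spacing s1 s2 m i.+1)^-1 * (row_fun u i - row_fun u i.+1)
        else 0) = lambda * row_fun u i)
   (u <= eigenspace (capacitance (4 * m).+1 (spacing s1 s2 m)) lambda)%MS.
Proof.
have rowE (i : 'I_(4 * m).+1) : (u *m capacitance (4 * m).+1 (spacing s1 s2 m)) ord0 i =
  \sum_(j < (4 * m).+1) row_fun u j * capacitance (4 * m).+1 (spacing s1 s2 m) j i.
  by rewrite mxE; apply: eq_bigr => j _; rewrite row_funE.
apply: (iffP eigenspaceP) => [ev i im|ev].
  have := congr1 (fun v : 'rV_(4 * m).+1 => v ord0 (inord i)) ev.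
  by rewrite rowE capacitance_sum mxE inordK // ltnS => ->.
apply/rowP => i; rewrite rowE capacitance_sum mxE row_funE ltnS.
by apply: ev; rewrite -ltnS.
Qed.

(** The sign sg is 1 for a mode even about the centre and -1 for an odd one. *)
Definition centred_mode m (sg x : R) : 'rV[R]_(4 * m).+1 :=
  \row_(i < (4 * m).+1) if (i <= 2 * m)%N then half_mode a b x i
                        else sg * half_mode a b x (4 * m - i).

Lemma centred_mode_left m sg x k : (k <= 2 * m)%N ->
  row_fun (centred_mode m sg x) k = half_mode a b x k.
Proof. by move=> km; rewrite /row_fun mxE inordK ?km //; lia. Qed.

Lemma centred_mode_right m sg x k : (k < 2 * m)%N ->
  row_fun (centred_mode m sg x) (4 * m - k) = sg * half_mode a b x k.
Proof.
move=> km; rewrite /row_fun mxE inordK; last by lia.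
by rewrite ifF; [congr (_ * half_mode _ _ _ _) | ]; lia.
Qed.

Lemma half_mode_centre m x :
  half_mode a b x (2 * m).+2 = (-1) ^+ m.+1 * dimer_u a b x m.+1 /\
  half_mode a b x (2 * m).+1 = (-1) ^+ m.+1 * dimer_v a b x m.+1.
Proof. by rewrite !mul2n -doubleS half_mode_even half_mode_odd. Qed.

Lemma centred_mode_neq0 m sg x : centred_mode m sg x != 0.
Proof.
apply/eqP => /(congr1 (fun v => row_fun v 0)).
rewrite centred_mode_left // half_mode0 /row_fun mxE => /eqP.
by rewrite oner_eq0.
Qed.
Hypotheses (s1_gt0 : 0 < s1) (s2_gt0 : 0 < s2).
Let a_gt0 : 0 < a. Proof. by rewrite invr_gt0. Qed.
Let b_gt0 : 0 < b. Proof. by rewrite invr_gt0. Qed.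

Lemma eigenvector_halves m (u : 'rV[R]_(4 * m).+1) (x : R) :
  (u <= eigenspace (capacitance (4 * m).+1 (spacing s1 s2 m)) (a + b - x))%MS ->
  forall k, (k <= 2 * m)%N ->
    row_fun u k = row_fun u 0 * half_mode a b x k /\
    row_fun u (4 * m - k) = row_fun u (4 * m) * half_mode a b x k.
Proof.
move/eigenspace_chainP => ev.
have cpl0 k : coupling a b k != 0 by rewrite /coupling; case: odd; rewrite lt0r_neq0.
(* The recursion has order two, so the induction carries two consecutive sites. *)
suff two k : (k < 2 * m)%N ->
    (row_fun u k = row_fun u 0 * half_mode a b x k /\
     row_fun u (4 * m - k) = row_fun u (4 * m) * half_mode a b x k) /\
    (row_fun u k.+1 = row_fun u 0 * half_mode a b x k.+1 /\
     row_fun u (4 * m - k.+1) = row_fun u (4 * m) * half_mode a b x k.+1).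
  case=> [_|k km]; first by rewrite subn0 half_mode0 !mulr1.
  by case: (two k km).
elim: k => [|k IHk] km.
  rewrite subn0 half_mode0 !mulr1; split=> //.
  have end_eq := half_mode_end x a_gt0 b_gt0.
  (* The end equation is read as a bulk equation with coupling 0 to a fictitious outer site. *)
  have {}end_eq : 0 * (half_mode a b x 0 - 0)
    + a * (half_mode a b x 0 - half_mode a b x 1) = (a + b - x) * half_mode a b x 0.
    by rewrite mul0r add0r.
  split; apply: (three_term_step (lt0r_neq0 a_gt0) end_eq); rewrite mul0r add0r half_mode0 mulr1.
    have := ev 0%N (leq0n _); rewrite /= add0r ifT; last by lia.
    by rewrite spacing_left //; lia.
  have := ev (4 * m)%N (leqnn _); rewrite ltnn addr0 ifT; last by lia.
  by have := @spacing_right m 0 km; rewrite subn0 subn1 => ->.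
have [[l0 r0] [l1 r1]] := IHk (ltnW km); split=> //.
have bulk_eq := half_mode_bulk x k a_gt0 b_gt0.
split; apply: (three_term_step (cpl0 k.+2) bulk_eq).
  rewrite -l0 -l1; have := ev k.+1; rewrite /= ifT; last by lia.
  by rewrite !spacing_left; try lia; apply; lia.
rewrite -r0 -r1 addrC; have := ev (4 * m - k.+1)%N (leq_subr _ _).
rewrite !ifT; try lia.
have -> : (4 * m - k.+1).+1 = (4 * m - k)%N by lia.
have -> : (4 * m - k.+1).-1 = (4 * m - k.+2)%N by lia.
by rewrite !spacing_right //; lia.
Qed.

(** The first condition makes the halves agree at the centre, the second is the equation there;
    elsewhere the recursion suffices. *)
Lemma centred_mode_eigen m sg x :
  (1 - sg) * dimer_u a b x m.+1 = 0 ->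
  (b - a + x) * dimer_u a b x m.+1 = b * (1 + sg) * dimer_v a b x m.+1 ->
  (centred_mode m.+1 sg x <=
     eigenspace (capacitance (4 * m.+1).+1 (spacing s1 s2 m.+1)) (a + b - x))%MS.
Proof.
move=> odd_cond centre_cond; apply/eigenspace_chainP => i im.
(* By [odd_cond] the formula for the right half extends to the centre itself. *)
have right k : (k <= 2 * m.+1)%N ->
    row_fun (centred_mode m.+1 sg x) (4 * m.+1 - k) = sg * half_mode a b x k.
  rewrite leq_eqVlt => /predU1P[->|]; last exact: centred_mode_right.
  rewrite (_ : (4 * m.+1 - 2 * m.+1 = 2 * m.+1)%N); last by lia.
  rewrite centred_mode_left // (_ : (2 * m.+1 = (2 * m).+2)%N); last by lia.
  have [-> _] := half_mode_centre m x.
  apply/eqP; rewrite -subr_eq0 -[X in X - _]mul1r -mulrBl mulrCA odd_cond mulr0.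
  by [].
have [i_lt|i_gt|i_mid] := ltngtP i (2 * m.+1).
- rewrite (_ : (i < 4 * m.+1)%N); last by lia.
  rewrite !centred_mode_left ?spacing_left; try lia.
  case: i {im} i_lt => [|i] i_lt; first by rewrite add0r; apply: half_mode_end.
  by rewrite /= half_mode_bulk.
- pose j := (4 * m.+1 - i)%N.
  have -> : i = (4 * m.+1 - j)%N by rewrite /j; lia.
  have : (j < 2 * m.+1)%N by rewrite /j; lia.
  move: j => j j_lt.
  have -> : (4 * m.+1 - j).-1 = (4 * m.+1 - j.+1)%N by lia.
  rewrite ifT; last by lia.
  rewrite spacing_right // !right; try lia.
  case: j j_lt => [|j] j_lt.
    by rewrite subn0 ltnn addr0 -mulrBr mulrCA half_mode_end // mulrCA.
  rewrite ifT; last by lia.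
  have -> : (4 * m.+1 - j.+1).+1 = (4 * m.+1 - j)%N by lia.
  rewrite right ?spacing_right; try lia.
  rewrite -[RHS]mulrCA -half_mode_bulk // [RHS]mulrDr addrC.
  by congr (_ + _); ring.
have {}i_mid : i = (2 * m).+2 by lia.
rewrite i_mid ifT /=; last by lia.
have mid : (2 * m).+3 = (4 * m.+1 - (2 * m).+1)%N by lia.
rewrite [in row_fun _ (2 * m).+3]mid right; last by lia.
rewrite !centred_mode_left; try lia.
rewrite spacing_left; last by lia.
rewrite mid spacing_right; last by lia.
have [-> ->] := half_mode_centre m x.
rewrite /coupling /= oddM /=.
set e := (-1) ^+ _.
transitivity (e * (2 * b * dimer_u a b x m.+1 - b * (1 + sg) * dimer_v a b x m.+1)).
  by ring.
by rewrite -centre_cond; ring.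
Qed.
(** Both halves are multiples of [half_mode]; they must meet at the centre and satisfy its
    equation. *)
Lemma eigenvector_centre m (u : 'rV[R]_(4 * m.+1).+1) x :
  (u <= eigenspace (capacitance (4 * m.+1).+1 (spacing s1 s2 m.+1)) (a + b - x))%MS ->
  let c := row_fun u 0 in let c' := row_fun u (4 * m.+1) in
  (c - c') * dimer_u a b x m.+1 = 0 /\
  c * ((b - a + x) * dimer_u a b x m.+1) = (c + c') * (b * dimer_v a b x m.+1).
Proof.
move=> ev c c'; have half := eigenvector_halves ev.
have mid : (2 * m).+2 = (4 * m.+1 - (2 * m).+2)%N by lia.
have [Eu Ev] := half_mode_centre m x.
have sgn0 : (-1) ^+ m.+1 != 0 :> R by rewrite signr_eq0.
have [|Ul Ur] := half (2 * m).+2; first by lia.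
move: Ur; rewrite -mid Ul Eu -/c -/c' => Ur.
split.
  by apply: (mulfI sgn0); rewrite mulr0 mulrCA mulrBl Ur subrr.
have [|Vl Vr] := half (2 * m).+1; first by lia.
have le_mid : ((2 * m).+2 <= 4 * m.+1)%N by lia.
have /eigenspace_chainP/(_ _ le_mid) := ev.
rewrite /= ifT; last by lia.
have mid3 : (2 * m).+3 = (4 * m.+1 - (2 * m).+1)%N by lia.
rewrite [in row_fun _ (2 * m).+3]mid3 Vr Vl Ul Eu Ev.
rewrite spacing_left; last by lia.
rewrite mid3 spacing_right; last by lia.
rewrite /coupling /= oddM /= -/a -/b -/c -/c' => H; apply: (mulfI sgn0).
move: H; set e := (-1) ^+ _ => H.
have : (2 * b - (a + b - x)) * (c * (e * dimer_u a b x m.+1)) =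
       e * ((c + c') * (b * dimer_v a b x m.+1)).
  by rewrite mulrBl -H; ring.
by move=> <-; ring.
Qed.

Lemma eigenvector_centred m (u : 'rV[R]_(4 * m.+1).+1) sg x :
  (u <= eigenspace (capacitance (4 * m.+1).+1 (spacing s1 s2 m.+1)) (a + b - x))%MS ->
  row_fun u (4 * m.+1) = sg * row_fun u 0 ->
  u = row_fun u 0 *: centred_mode m.+1 sg x.
Proof.
move=> ev c'E; have half := eigenvector_halves ev.
apply/rowP => i; rewrite !mxE row_funE; case: leqP => im.
  by have [->] := half _ im.
have [|_] := half (4 * m.+1 - i)%N; first by lia.
rewrite subKn; last by have := ltn_ord i; lia.
by move=> ->; rewrite c'E; ring.
Qed.

End Chain.

(** * Band gap and decay rate *)

Lemma le_row_norm (R : realType) n (u : 'rV[R]_n.+1) (i : 'I_n.+1) : `|u ord0 i| <= `|u|.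
Proof.
rewrite [leRHS]/Num.norm /= mx_normrE.
exact: (le_bigmax _ (fun ij => `|u ij.1 ij.2|) (ord0, i)).
Qed.

Section Gap.
Variables (R : realType) (s1 s2 : R).
Hypotheses (s1_gt0 : 0 < s1) (s2_gt0 : 0 < s2).
Let a := s1^-1.
Let b := s2^-1.
Let L := cell_length s1 s2.
Let a_gt0 : 0 < a. Proof. by rewrite invr_gt0. Qed.
Let b_gt0 : 0 < b. Proof. by rewrite invr_gt0. Qed.
Let L_gt0 : 0 < L. Proof. by rewrite /L /cell_length !addr_gt0. Qed.

Lemma radicandE (c : R) : radicand s1 s2 c = a ^+ 2 + b ^+ 2 + 2 * a * b * c.
Proof. by rewrite /radicand /a /b; field; rewrite !lt0r_neq0. Qed.

(** P is meant to be the dominant sequence: it bounds both sequences and gains a factor z per cell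
    towards the centre. *)
Lemma centred_mode_decays m sg x (P : nat -> R) z : 0 < z -> `|sg| = 1 ->
  (forall n, `|dimer_u a b x n| <= P n /\ `|dimer_v a b x n| <= P n) ->
  (forall n k, z ^+ k * P n <= P (n + k)%N) ->
  P m <= `|centred_mode s1 s2 m sg x| ->
  decays_from_centre s1 s2 1 (ln z / L) (centred_mode s1 s2 m sg x).
Proof.
move=> z0 sg1 P_ge P_growth P_le i; cbv zeta; set cells := (_ %/ _)%N; rewrite mul1r.
have -> : expR (- (ln z / L) * cell_length s1 s2 * cells%:R) = z^-1 ^+ cells.
  by rewrite -/L mulNr divfK ?lt0r_neq0 // expRM_natr expRN lnK.
(* Halving the distance 2 m - k and rounding down gives m - [uphalf] k, for either parity of k. *)
have half k : (k <= 2 * m)%N -> cells = (m - uphalf k)%N ->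
    `|half_mode a b x k| <= z^-1 ^+ cells * `|centred_mode s1 s2 m sg x|.
  move=> km ->; rewrite /half_mode normrMsign.
  apply: (@le_trans _ _ (P (uphalf k))).
    by have [Pu Pv] := P_ge (uphalf k); case: odd.
  have := P_growth (uphalf k) (m - uphalf k)%N; rewrite subnKC; last by lia.
  move=> growth; rewrite exprVn mulrC ler_pdivlMr ?exprn_gt0 // mulrC.
  exact: le_trans growth P_le.
rewrite mxE; case: leqP => im; first by apply: half => //; rewrite /cells; lia.
by rewrite normrM sg1 mul1r; apply: half; rewrite /cells; have := ltn_ord i; lia.
Qed.

Variable delta : R.
Hypothesis delta_gt0 : 0 < delta.

Lemma le_frequency (l l' : R) : l <= l' -> frequency delta l <= frequency delta l'.
Proof. by move=> ll'; rewrite /frequency ler_wsqrtr // ler_pM2l. Qed.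

(** The larger value has to be positive, since [Num.sqrt] is 0 on all negative numbers. *)
Lemma lt_frequency (l l' : R) : 0 < l' -> l < l' -> frequency delta l < frequency delta l'.
Proof. by move=> l'0 ll'; rewrite /frequency ltr_sqrt ?mulr_gt0 // ltr_pM2l. Qed.

Lemma frequency_inj (l l' : R) : 0 < l -> frequency delta l = frequency delta l' -> l = l'.
Proof.
move=> l0 ll'; have [lt_ll'|lt_l'l|//] := ltgtP l l'.
  by have := lt_frequency (lt_trans l0 lt_ll') lt_ll'; rewrite ll' ltxx.
by have := lt_frequency l0 lt_l'l; rewrite ll' ltxx.
Qed.

Let gap_lt_sum : `|a - b| < a + b.
Proof. by have [a0 b0] := (a_gt0, b_gt0); rewrite ltr_norml; lra. Qed.

Lemma shift_lt_sum x : `|x| < `|a - b| -> 0 < a + b - x.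
Proof.
move=> xgap; have := lt_trans xgap gap_lt_sum.
by rewrite ltr_norml subr_gt0 => /andP[].
Qed.

Lemma in_band_gapP x :
  in_band_gap s1 s2 delta (frequency delta (a + b - x)) <-> `|x| < `|a - b|.
Proof.
split=> [gap|xgap alpha].
  (* At quasimomentum pi / L the levels are the gap edges a + b - |a - b| and a + b + |a - b|. *)
  have := gap (pi / L); rewrite /band -/L divfK ?lt0r_neq0 // cospi /level.
  have -> : radicand s1 s2 (-1) = (a - b) ^+ 2 by rewrite radicandE; ring.
  rewrite sqrtr_sqr -/a -/b => /andP[lo hi].
  rewrite ltr_norml; apply/andP; split; rewrite ltNge; apply/negP => x_ge.
    by move: hi; rewrite ltNge le_frequency //; lra.
  by move: lo; rewrite ltNge le_frequency //; lra.
have rad_ge : `|a - b| <= Num.sqrt (radicand s1 s2 (cos (alpha * cell_length s1 s2))).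
  rewrite -sqrtr_sqr ler_wsqrtr // radicandE.
  have := cos_geN1 (alpha * cell_length s1 s2); set c := cos _ => c1.
  have : 0 <= 2 * a * b * (c + 1) by rewrite !mulr_ge0 ?(ltW a_gt0) ?(ltW b_gt0) //; lra.
  by lra.
have := shift_lt_sum xgap; move: xgap; rewrite ltr_norml => /andP[lo hi] x_lt.
by apply/andP; split; apply: lt_frequency; rewrite /level -/a -/b //; lra.
Qed.

Lemma cosh_ln (z : R) : 0 < z -> cosh (ln z) = (z + z^-1) / 2.
Proof. by move=> z0; rewrite /cosh expRN lnK. Qed.

Lemma decay_rateP x beta : `|x| < `|a - b| ->
  decay_rate s1 s2 delta (frequency delta (a + b - x)) beta <->
  beta = ln (multiplier (cell_trace a b x)) / L.
Proof.
move=> xgap; have t2 := cell_trace_gt2 a_gt0 b_gt0 xgap.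
have [z1 tz] := (multiplier_gt1 t2, multiplierE t2).
set z := multiplier _ in z1 tz *.
have z0 : 0 < z by lra.
have x_lt := shift_lt_sum xgap.
have tE : 2 * a * b * (cell_trace a b x / 2) = a ^+ 2 + b ^+ 2 - x ^+ 2.
  by rewrite /cell_trace; field; rewrite !lt0r_neq0.
split=> [[beta0 [alpha [upper [c [c_def rad0 lev0 om]]]]]|->].
  have x2 : radicand s1 s2 c = x ^+ 2.
    have := frequency_inj x_lt om; rewrite /level -/a -/b.
    have := sqr_sqrtr rad0; set w := Num.sqrt _ => <-.
    case: upper {lev0 om} => lev; last by rewrite (_ : x = w) //; lra.
    by rewrite (_ : x = - w) ?sqrrN //; lra.
  have bL : 0 < beta * L by rewrite mulr_gt0.
  pose y := expR (beta * L).
  have y1 : 1 < y by rewrite /y expR_gt1.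
  have y0 : 0 < y by rewrite expR_gt0.
  have coshE : cosh (beta * L) = (y + y^-1) / 2 by rewrite /cosh expRN.
  have yi0 : 0 < y^-1 by rewrite invr_gt0.
  have cE : 2 * a * b * c = - (2 * a * b * (cell_trace a b x / 2)).
    by rewrite tE -x2 radicandE; ring.
  have {}cE : c = - (cell_trace a b x / 2).
    by move: cE; rewrite -mulrN => /mulfI; apply; rewrite !mulf_neq0 ?lt0r_neq0.
  have yz : y = z.
    apply: multiplier_unique => //; rewrite -tz.
    (* The case alpha = 0 needs c > 0, but c = - t / 2 < 0; the other case says y + 1/y = t. *)
    by case: c_def => -[_]; rewrite coshE; lra.
  by rewrite -yz /y expRK mulfK ?lt0r_neq0.
split; first by rewrite divr_gt0 ?ln_gt0.
(* The level a + b - x belongs to the upper branch exactly when x < 0. *)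
exists (pi / L), (x < 0), (- (cell_trace a b x / 2)); rewrite -/L divfK ?lt0r_neq0 //.
have radE : radicand s1 s2 (- (cell_trace a b x / 2)) = x ^+ 2.
  by rewrite radicandE mulrN tE; ring.
have levE : level s1 s2 (x < 0) (- (cell_trace a b x / 2)) = a + b - x.
  rewrite /level radE sqrtr_sqr -/a -/b; case: ltrP => x0.
    by rewrite ltr0_norm.
  by rewrite ger0_norm.
rewrite radE levE sqr_ge0 (ltW x_lt); split=> //; right; split.
  by rewrite ger0_norm // divr_ge0 ?pi_ge0 // ltW.
by rewrite cosh_ln // -tz.
Qed.

End Gap.

(** * Existence and convergence *)

Lemma bernoulli (R : realFieldType) (z : R) n : 1 <= z -> n%:R * (z - 1) <= z ^+ n.
Proof.
move=> z1; suff : 1 + n%:R * (z - 1) <= z ^+ n by lra.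
elim: n => [|n IHn]; first by rewrite mul0r addr0.
have := mulr_ge0 (ler0n R n) (sqr_ge0 (z - 1)).
have : z * (1 + n%:R * (z - 1)) <= z * z ^+ n by rewrite ler_wpM2l //; lra.
rewrite -natr1 [z ^+ n.+1]exprS; lra.
Qed.

Lemma geometric_small (R : archiRealFieldType) (z e : R) : 1 < z -> 0 < e ->
  exists n0, forall n, (n0 <= n)%N -> z^-1 ^+ n <= e.
Proof.
move=> z1 e0; have d0 : 0 < (z - 1) * e by rewrite mulr_gt0 ?subr_gt0.
have z0 : 0 < z by rewrite (lt_trans ltr01).
exists (Num.bound ((z - 1) * e)^-1) => n n_ge.
rewrite exprVn -div1r ler_pdivrMr ?exprn_gt0 //.
apply: le_trans (_ : e * (n%:R * (z - 1)) <= _); last by rewrite ler_pM2l // bernoulli // ltW.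
have n_large : ((z - 1) * e)^-1 <= n%:R.
  apply: ltW; apply: lt_le_trans (archi_boundP _) _; rewrite ?invr_ge0 ?(ltW d0) //.
  by rewrite ler_nat.
have := ler_wpM2r (ltW d0) n_large; rewrite mulVf ?lt0r_neq0 //; lra.
Qed.

(** From ln (1 + h) <= h with h = (y' - y) / y and y > 1. *)
Lemma ln_lipschitz (R : realType) (z z' : R) : 1 < z -> 1 < z' ->
  `|ln z' - ln z| <= `|z' - z|.
Proof.
have aux (y y' : R) : 1 < y -> y <= y' -> ln y' - ln y <= y' - y.
  move=> y1 yy'; have y0 : 0 < y by lra.
  have y'0 : 0 < y' by lra.
  rewrite -ln_div ?posrE //.
  have -> : y' / y = 1 + (y' - y) / y by field; rewrite lt0r_neq0.
  apply: le_trans (le_ln1Dx _) _.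
    by apply: lt_le_trans (_ : 0 <= _); [lra | rewrite divr_ge0 //; lra].
  by rewrite ler_pdivrMr // ler_peMr // ?subr_ge0 // ltW.
move=> z1 z'1; have [z0 z'0] : 0 < z /\ 0 < z' by split; lra.
have [le_zz'|/ltW le_z'z] := leP z z'.
  rewrite !ger0_norm ?subr_ge0 //; first exact: aux.
  by rewrite ler_ln ?posrE.
rewrite distrC [leRHS]distrC !ger0_norm ?subr_ge0 //; first exact: aux.
by rewrite ler_ln ?posrE.
Qed.

Lemma sqrtc_neg (R : rcfType) (y : R) : 0 <= y ->
  sqrtc ((- y)%:C)%C = (0 +i* Num.sqrt y)%C.
Proof.
move=> y0; rewrite /sqrtc /= eqxx mul1r expr0n addr0 sqrrN sqrtr_sqr ger0_norm //.
by rewrite subrr mul0r sqrtr0 opprK (_ : (y + y) / 2 = y) //; field.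
Qed.

(** Below -1 both principal square roots are purely imaginary; their product is a negative real
    number, which adds to - t / 2 without cancellation. *)
Lemma Re_arcosh_neg (R : realType) (t : R) : 2 < t ->
  Re_arcosh (- (t / 2)) = ln (multiplier t).
Proof.
move=> t2; rewrite /Re_arcosh; congr ln.
have -> : ((- (t / 2))%:C - 1 = (- (t / 2 + 1))%:C)%C by rewrite opprD rmorphB.
have -> : ((- (t / 2))%:C + 1 = (- (t / 2 - 1))%:C)%C by rewrite opprB [1 - _]addrC rmorphD.
rewrite !sqrtc_neg; try lra.
rewrite /multiplier.
have -> : Num.sqrt (t ^+ 2 - 4) = 2 * (Num.sqrt (t / 2 + 1) * Num.sqrt (t / 2 - 1)).
  rewrite -sqrtrM; last by lra.
  rewrite (_ : t ^+ 2 - 4 = 2 ^+ 2 * ((t / 2 + 1) * (t / 2 - 1))); last by field.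
  by rewrite [LHS]sqrtrM ?sqr_ge0 // sqrtr_sqr ger0_norm.
have p0 := mulr_ge0 (sqrtr_ge0 (t / 2 + 1)) (sqrtr_ge0 (t / 2 - 1)).
set p := Num.sqrt _ in p0 *; set q := Num.sqrt _ in p0 *.
have -> : ((- (t / 2))%:C + (0 +i* p) * (0 +i* q) = (- (t / 2 + p * q))%:C)%C.
  by rewrite /real_complex_def; simpc; congr (_ +i* _)%C; ring.
by rewrite /= expr0n addr0 sqrrN sqrtr_sqr ger0_norm; [field | lra].
Qed.

(** * Interface modes from solutions of the centre conditions *)

Section Interface.
Variables (R : realType) (s1 s2 delta : R).
Hypotheses (s1_gt0 : 0 < s1) (s2_gt0 : 0 < s2) (delta_gt0 : 0 < delta).
Let a := s1^-1.
Let b := s2^-1.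
Let a_gt0 : 0 < a. Proof. by rewrite invr_gt0. Qed.
Let b_gt0 : 0 < b. Proof. by rewrite invr_gt0. Qed.

Definition shift_frequency (x : R) : R := frequency delta (s1^-1 + s2^-1 - x).
Definition shift_decay (x : R) : R :=
  ln (multiplier (cell_trace s1^-1 s2^-1 x)) / cell_length s1 s2.

(** The gap frequency and the decay rate are determined by one parameter x, so uniqueness reduces to
    identifying x and the eigenvector. *)
Lemma interface_mode_shift K m omega beta (u : 'rV[R]_(4 * m).+1) :
  interface_mode s1 s2 delta K omega beta u ->
  exists x, [/\ `|x| < `|a - b|, omega = shift_frequency x, beta = shift_decay x, u != 0
    & (u <= eigenspace (capacitance (4 * m).+1 (spacing s1 s2 m)) (a + b - x))%MS].
Proof.
case=> [[u0 [lambda ev ->]] gap decay _].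
have lE : lambda = a + b - (a + b - lambda) by rewrite subKr.
move: ev gap decay; rewrite lE; move: (a + b - lambda) => x ev gap decay.
have xgap : `|x| < `|a - b| by apply/(in_band_gapP s1_gt0 s2_gt0 delta_gt0).
by exists x; split=> //; apply/(decay_rateP s1_gt0 s2_gt0 delta_gt0 _ xgap).
Qed.

Lemma centred_interface_mode m sg x (P : nat -> R) : `|x| < `|a - b| -> `|sg| = 1 ->
  (forall n, `|dimer_u a b x n| <= P n /\ `|dimer_v a b x n| <= P n) ->
  (forall n, P n.+2 = cell_trace a b x * P n.+1 - P n) ->
  multiplier (cell_trace a b x) * P 0%N <= P 1%N ->
  P m.+1 <= `|centred_mode s1 s2 m.+1 sg x| ->
  (1 - sg) * dimer_u a b x m.+1 = 0 ->
  (b - a + x) * dimer_u a b x m.+1 = b * (1 + sg) * dimer_v a b x m.+1 ->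
  interface_mode s1 s2 delta 1 (shift_frequency x) (shift_decay x)
    (centred_mode s1 s2 m.+1 sg x).
Proof.
move=> xgap sg1 P_ge P_rec P1 P_le odd_cond even_cond.
have t2 := cell_trace_gt2 a_gt0 b_gt0 xgap.
have [z1 tz] := (multiplier_gt1 t2, multiplierE t2).
have z0 : 0 < multiplier (cell_trace a b x) by rewrite (lt_trans ltr01).
split.
- split; first exact: centred_mode_neq0.
  by exists (a + b - x) => //; apply: centred_mode_eigen.
- exact/(in_band_gapP s1_gt0 s2_gt0 delta_gt0).
- exact/(decay_rateP s1_gt0 s2_gt0 delta_gt0 _ xgap).
apply: (centred_mode_decays s1_gt0 s2_gt0 z0 sg1 P_ge _ P_le) => n k.
by apply: rec2_growth z0 _ P1 n k => j; rewrite -tz.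
Qed.

Lemma strong_end_interface m x : s1 < s2 -> 0 <= x -> x < a - b -> centre_even a b m.+1 x ->
  interface_mode s1 s2 delta 1 (shift_frequency x) (shift_decay x)
    (centred_mode s1 s2 m.+1 1 x) /\
  forall K omega beta (u : 'rV[R]_(4 * m.+1).+1),
    interface_mode s1 s2 delta K omega beta u ->
    [/\ omega = shift_frequency x, beta = shift_decay x
      & exists k, u = k *: centred_mode s1 s2 m.+1 1 x].
Proof.
move=> s12 x0 xD root.
have ba : b < a by rewrite /a /b ltf_pV2 ?posrE.
have Dnorm : `|a - b| = a - b by rewrite gtr0_norm ?subr_gt0.
have xgap : `|x| < a - b by rewrite ger0_norm.
have dom y (ygap : `|y| < a - b) n := strong_end_dominated b_gt0 ba ygap n.
split=> [|K omega beta u /interface_mode_shift[y [ygap -> -> u0 ev]]].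
  have xgap' : `|x| < `|a - b| by rewrite Dnorm.
  have t2 := cell_trace_gt2 a_gt0 b_gt0 xgap'.
  apply: (@centred_interface_mode _ _ _ (dimer_u a b x)) => //.
  - by rewrite normr1.
  - by move=> n; have [u1 vu] := dom _ xgap n; rewrite ger0_norm // (le_trans ler01).
  - exact: dimer_u_rec.
  - rewrite [dimer_u a b x 0]/(1 : R) mulr1; apply: strong_end_growth => //.
      exact: multiplier_gt1.
    exact: multiplierE.
  (* The maximum norm is bounded below by the value at the centre, which is u (m+1) up to sign. *)
  - have := le_row_norm (centred_mode s1 s2 m.+1 1 x) (inord (2 * m).+2).
    rewrite -/(row_fun _ _) centred_mode_left; last by lia.
    have [-> _] := half_mode_centre s1 s2 m x.
    by rewrite normrMsign; apply: le_trans; exact: ler_norm.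
  - by rewrite subrr mul0r.
  - by rewrite -root -/(1 + 1); ring.
rewrite Dnorm in ygap.
have [] := eigenvector_centre s1_gt0 s2_gt0 ev.
have [u1 _] := dom _ ygap m.+1.
have un0 : dimer_u a b y m.+1 != 0 by rewrite gt_eqF // (lt_le_trans ltr01).
(* As u is nonzero at the centre, the two end values agree and the mode is even. *)
move=> /eqP; rewrite mulf_eq0 (negbTE un0) orbF subr_eq0 => /eqP cE.
rewrite -/a -/b => centre.
have uE : u = row_fun u 0 *: centred_mode s1 s2 m.+1 1 y.
  by apply: eigenvector_centred ev _ => //; rewrite mul1r.
have c0 : row_fun u 0 != 0.
  by apply: contraNneq u0 => c0; rewrite uE c0 scale0r.
have yroot : centre_even a b m.+1 y.
  by rewrite /centre_even; apply: (mulfI c0); rewrite centre -cE; ring.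
have yx : y = x by exact: strong_end_even_unique ygap xgap _ yroot root.
by rewrite -yx; split=> //; exists (row_fun u 0).
Qed.

Lemma weak_end_interface m x : s2 < s1 -> x <= 0 -> a - b < x -> centre_odd a b m.+1 x ->
  interface_mode s1 s2 delta 1 (shift_frequency x) (shift_decay x)
    (centred_mode s1 s2 m.+1 (-1) x) /\
  forall K omega beta (u : 'rV[R]_(4 * m.+1).+1),
    interface_mode s1 s2 delta K omega beta u ->
    [/\ omega = shift_frequency x, beta = shift_decay x
      & exists k, u = k *: centred_mode s1 s2 m.+1 (-1) x].
Proof.
move=> s21 x0 xD root.
have ab : a < b by rewrite /a /b ltf_pV2 ?posrE.
have Dnorm : `|a - b| = b - a by rewrite distrC gtr0_norm ?subr_gt0.
have xgap : `|x| < b - a by rewrite ler0_norm //; lra.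
have dom y (ygap : `|y| < b - a) n := weak_end_dominated a_gt0 ab ygap n.
split=> [|K omega beta u /interface_mode_shift[y [ygap -> -> u0 ev]]].
  have xgap' : `|x| < `|a - b| by rewrite Dnorm.
  have t2 := cell_trace_gt2 a_gt0 b_gt0 xgap'.
  apply: (@centred_interface_mode _ _ _ (dimer_v a b x)) => //.
  - by rewrite normrN normr1.
  - by move=> n; have [v1 uv] := dom _ xgap n; rewrite [`|dimer_v _ _ _ _|]ger0_norm // (le_trans ler01).
  - exact: dimer_v_rec.
  - rewrite [dimer_v a b x 0]/(1 : R) mulr1; apply: weak_end_growth => //.
      exact: multiplier_gt1.
    exact: multiplierE.
  (* The centre carries 0, so its left neighbour, with value v (m+1) up to sign, is used instead. *)
  - have := le_row_norm (centred_mode s1 s2 m.+1 (-1) x) (inord (2 * m).+1).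
    rewrite -/(row_fun _ _) centred_mode_left; last by lia.
    have [_ ->] := half_mode_centre s1 s2 m x.
    by rewrite normrMsign; apply: le_trans; exact: ler_norm.
  - by rewrite root mulr0.
  - by rewrite root subrr !(mulr0, mul0r).
have ygap' := ygap; rewrite Dnorm in ygap.
have := eigenvector_centre s1_gt0 s2_gt0 ev; rewrite -/a -/b => -[u_eq centre].
have [v1 _] := dom _ ygap m.+1.
have not_even : row_fun u (4 * m.+1) = row_fun u 0 -> False.
  move=> cE; have uE : u = row_fun u 0 *: centred_mode s1 s2 m.+1 1 y.
    by apply: eigenvector_centred ev _ => //; rewrite mul1r.
  have c0 : row_fun u 0 != 0.
    by apply: contraNneq u0 => c0; rewrite uE c0 scale0r.
  apply: (weak_end_no_even a_gt0 ab ygap (m := m.+1)).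
  by rewrite /centre_even; apply: (mulfI c0); rewrite centre cE; ring.
(* Equal end values would give an even mode, so u must vanish at the centre. *)
have yroot : centre_odd a b m.+1 y.
  move/eqP: u_eq; rewrite mulf_eq0 subr_eq0 => /orP[/eqP cE|/eqP //].
  by case: not_even.
have cE : row_fun u (4 * m.+1) = -1 * row_fun u 0.
  move/esym/eqP: centre; rewrite yroot !mulr0 mulf_eq0 => /orP[|]; last first.
    by rewrite mulf_eq0 !gt_eqF // (lt_le_trans ltr01).
  by rewrite addrC addr_eq0 mulN1r => /eqP.
have uE : u = row_fun u 0 *: centred_mode s1 s2 m.+1 (-1) y.
  exact: eigenvector_centred ev cE.
have yx : y = x by exact: weak_end_odd_unique ygap xgap _ yroot root.
by rewrite -yx; split=> //; exists (row_fun u 0).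
Qed.

(** The square of [omega_i] over delta is a + b minus the limit shift, and the argument of arcosh
    becomes - t / 2 with t the trace at that shift. *)
Lemma beta_iE : s1 < s2 -> beta_i s1 s2 delta = shift_decay (limit_shift a b).
Proof.
move=> s12; have ba : b < a by rewrite /a /b ltf_pV2 ?posrE.
have /andP[xi0 xiD] := limit_shift_gap b_gt0 ba.
have [a0 b0] := (a_gt0, b_gt0).
have t2 : 2 < cell_trace a b (limit_shift a b).
  by apply: cell_trace_gt2; rewrite // !gtr0_norm // subr_gt0.
have om2 : omega_i s1 s2 delta ^+ 2 / delta = a + b - limit_shift a b.
  rewrite /omega_i.
  have -> : 2^-1 * (- Num.sqrt (9 / s1 ^+ 2 - 14 / (s1 * s2) + 9 / s2 ^+ 2)
     + 3 / s1 + 3 / s2) = a + b - limit_shift a b.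
    rewrite /limit_shift (_ : 9 / s1 ^+ 2 - _ + _ = (a + b) ^+ 2 + 8 * (a - b) ^+ 2).
      by rewrite /a /b; field; rewrite !lt0r_neq0.
    by rewrite /a /b; field; rewrite !lt0r_neq0.
  by rewrite sqr_sqrtr ?mulr_ge0 ?(ltW delta_gt0) //; [rewrite mulrAC divff ?mul1r ?lt0r_neq0 | lra].
rewrite /beta_i /shift_decay om2 mulrC -Re_arcosh_neg //; congr (Re_arcosh _ / _).
by rewrite -/a -/b /cell_trace /a /b; field; rewrite !lt0r_neq0.
Qed.
End Interface.

(** * Long chains: existence threshold and rate of convergence *)

Lemma strong_end_roots (R : realType) (a b y : R) : 0 < b -> b < a ->
  limit_shift a b < y -> y < a - b ->
  exists n0, forall n, (n0 <= n)%N ->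
    exists x, limit_shift a b <= x <= y /\ centre_even a b n.+1 x.
Proof.
move=> b0 ba xiy yD; have a0 : 0 < a by exact: lt_trans ba.
have /andP[xi0 xiD] := limit_shift_gap b0 ba.
have y0 : 0 < y by exact: lt_trans xiy.
have ygap : `|y| < a - b by rewrite gtr0_norm.
have t2 : 2 < cell_trace a b y.
  by apply: cell_trace_gt2; rewrite // [`|a - b|]gtr0_norm // subr_gt0.
have [z1 tz] := (multiplier_gt1 t2, multiplierE t2).
set z := multiplier _ in z1 tz.
have z0 : 0 < z by lra.
have xiE := limit_shift_root a b.
have y_ge : 2 * (a - b) ^+ 2 < y ^+ 2 + (a + b) * y.
  move: (limit_shift a b) xiy xi0 xiE => xi xiy xi0 xiE.
  have : 0 < (y - xi) * (y + xi + (a + b)) by rewrite mulr_gt0 //; lra.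
  by lra.
(* Equality would annul the left side of [centre_ratio_defect], while no factor on the right
   vanishes at y. *)
have rho_lt : centre_ratio a b y < z^-1.
  rewrite lt_neqAle (centre_ratio_le b0 ba y0 yD z1 tz (ltW y_ge)) andbT.
  apply/eqP => rhoE; have := centre_ratio_defect a0 b0 (lt0r_neq0 z0) tz.
  rewrite rhoE subrr !mul0r => /esym/eqP.
  by rewrite !mulf_eq0 !gt_eqF ?invr_gt0 //; lra.
have u1 := strong_end_growth b0 ba ygap (ltW y0) z1 tz.
(* The added 1 keeps the denominator positive, since u 1 >= z only gives a nonnegative
   difference. *)
pose e := (z^-1 - centre_ratio a b y) / (dimer_u a b y 1 - z + 1).
have e0 : 0 < e by rewrite divr_gt0 ?subr_gt0 //; lra.
have [n0 small] := geometric_small z1 e0.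
exists n0 => n n_ge; apply: (strong_end_even_exists b0 ba xiy yD z1 tz).
have := small n.+1 (leqW n_ge); rewrite ler_pdivlMr; last by lra.
apply: le_trans; rewrite ler_wpM2l ?exprn_ge0 ?invr_ge0 ?(ltW z0) //; lra.
Qed.

(** The root estimate passes through Lipschitz bounds for the trace, the multiplier and the
    logarithm. The multiplier decreases in x, so its value at y serves as a base q uniform in x. *)
Lemma strong_end_decay_estimate (R : realType) (s1 s2 y : R) : 0 < s1 -> s1 < s2 ->
  let a := s1^-1 in let b := s2^-1 in
  limit_shift a b < y -> y < a - b ->
  exists A q : R, [/\ 0 < A, 1 < q & forall x n, limit_shift a b <= x <= y ->
    centre_even a b n.+1 x ->
    `|shift_decay s1 s2 x - shift_decay s1 s2 (limit_shift a b)| <= A * q^-1 ^+ n.+1].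
Proof.
move=> s1_gt0 s12 a b xiy yD; have s2_gt0 : 0 < s2 by exact: lt_trans s12.
have a0 : 0 < a by rewrite invr_gt0.
have b0 : 0 < b by rewrite invr_gt0.
have ba : b < a by rewrite /a /b ltf_pV2 ?posrE.
have /andP[xi0 xiD] := limit_shift_gap b0 ba.
have L0 : 0 < cell_length s1 s2 by rewrite /cell_length !addr_gt0.
have t_gt2 w : 0 < w -> w < a - b -> 2 < cell_trace a b w.
  by move=> w0 wD; apply: cell_trace_gt2; rewrite // !gtr0_norm // subr_gt0.
have y0 : 0 < y by exact: lt_trans xiy.
set xi := limit_shift a b in xiy xi0 xiD *.
pose zeta w := multiplier (cell_trace a b w).
have zeta_gt1 w : 0 < w -> w < a - b -> 1 < zeta w.
  by move=> w0 wD; apply/multiplier_gt1/t_gt2.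
have zetaE w : 0 < w -> w < a - b -> cell_trace a b w = zeta w + (zeta w)^-1.
  by move=> w0 wD; apply/multiplierE/t_gt2.
pose C := 4 * a ^+ 2 * b / ((a + b) * xi).
(* Lipschitz constants of the trace and of the multiplier times the root constant C; the logarithm
   contributes 1, and L comes from the definition of the rate. *)
pose A := (2 * (a - b) / (a * b) * C) / (1 - (zeta xi)^-1) / cell_length s1 s2.
have zi_lt1 : (zeta xi)^-1 < 1.
  by rewrite invf_lt1 ?zeta_gt1 // (lt_trans ltr01) ?zeta_gt1.
have C0 : 0 < C.
  rewrite /C; apply: divr_gt0; last exact: mulr_gt0 (addr_gt0 a0 b0) xi0.
  by rewrite !mulr_gt0.
have D0 : 0 < 2 * (a - b) / (a * b).
  by apply: divr_gt0; apply: mulr_gt0; rewrite ?subr_gt0.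
exists A, (zeta y); split; last 1 first.
- move=> x n /andP[xix xy] root.
  have x0 : 0 < x by exact: lt_le_trans xix.
  have xD : x < a - b by exact: le_lt_trans yD.
  have zx1 := zeta_gt1 x x0 xD; have zy1 := zeta_gt1 y y0 yD.
  have zi1 := zeta_gt1 xi xi0 xiD.
  have zx0 : 0 < zeta x by rewrite (lt_trans ltr01).
  have zy0 : 0 < zeta y by rewrite (lt_trans ltr01).
  have ab0 : 0 < a * b by rewrite mulr_gt0.
  have zyx : zeta y <= zeta x.
    apply: multiplier_mono; rewrite // -!zetaE // ler_pM2r ?invr_gt0 // lerD2l lerN2.
    by rewrite ler_pXn2r ?nnegrE ?(ltW x0) ?(ltW y0).
  have x_dist : x - xi <= C * (zeta y)^-1 ^+ n.+1.
    apply: le_trans (even_root_estimate b0 ba xix xD zx1 (zetaE x x0 xD) root) _.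
    rewrite ler_pM2l // ler_pXn2r ?nnegrE ?invr_ge0 ?(ltW zx0) ?(ltW zy0) //.
    by rewrite lef_pV2 ?posrE.
  have t_dist : `|cell_trace a b x - cell_trace a b xi| <= 2 * (a - b) / (a * b) * (x - xi).
    rewrite (_ : _ - _ = - ((x + xi) / (a * b) * (x - xi))); last first.
      by rewrite /cell_trace; field; rewrite !lt0r_neq0.
    rewrite normrN ger0_norm; last by rewrite mulr_ge0 ?divr_ge0 ?(ltW ab0) //; lra.
    by rewrite ler_wpM2r ?subr_ge0 // ler_pM2r ?invr_gt0 //; lra.
  have z_dist := multiplier_lipschitz zi1 zx1.
  rewrite -!zetaE // in z_dist.
  rewrite /shift_decay -mulrBl normrM [`|_^-1|]gtr0_norm ?invr_gt0 //.
  rewrite /A mulrAC ler_pM2r ?invr_gt0 // mulrAC ler_pdivlMr ?subr_gt0 //.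
  apply: le_trans (_ : `|zeta x - zeta xi| * (1 - (zeta xi)^-1) <= _).
    by rewrite ler_pM2r ?subr_gt0 // ln_lipschitz.
  apply: le_trans z_dist _; apply: le_trans t_dist _.
  by rewrite -[leRHS]mulrA ler_pM2l.
- by rewrite /A divr_gt0 ?(divr_gt0 (mulr_gt0 D0 C0)) ?subr_gt0.
- exact: zeta_gt1.
Qed.

Theorem corollary2p6 (R : realType) (s1 s2 delta : R)
    (s1_gt0 : 0 < s1) (s2_gt0 : 0 < s2) (delta_gt0 : 0 < delta)
    (s1_neq_s2 : s1 != s2) :
  exists (K : R) (m0 : nat) (omega beta : nat -> R)
         (u : forall m : nat, 'rV[R]_(4 * m).+1),
    [/\ 0 < K,
        forall m : nat, (m0 <= m)%N ->
          interface_mode s1 s2 delta K (omega m) (beta m) (u m) /\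
          forall (K' omega' beta' : R) (u' : 'rV[R]_(4 * m).+1),
            interface_mode s1 s2 delta K' omega' beta' u' ->
            [/\ omega' = omega m, beta' = beta m
              & exists k : R, u' = k *: u m]
      & s1 < s2 ->
        exists A c : R,
          [/\ 0 < A, 0 < c
            & forall m : nat, (m0 <= m)%N ->
                `|beta m - beta_i s1 s2 delta|
                  <= A * expR (- c * (4 * m + 1)%:R)] ].
Proof.
pose a := s1^-1; pose b := s2^-1.
have a0 : 0 < a by rewrite invr_gt0.
have b0 : 0 < b by rewrite invr_gt0.
(* The growth by z per cell towards the centre holds without a constant, so K = 1 serves every m. *)
exists 1.
move: s1_neq_s2; rewrite neq_lt => /orP[s12|s21].
- have ba : b < a by rewrite /a /b ltf_pV2 ?posrE.
  have /andP[xi0 xiD] := limit_shift_gap b0 ba.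
  (* The midpoint keeps the roots away from the gap edge, where the multiplier tends to 1. *)
  pose y := (limit_shift a b + (a - b)) / 2.
  have xiy : limit_shift a b < y by rewrite /y ltr_pdivlMr //; lra.
  have yD : y < a - b by rewrite /y ltr_pdivrMr //; lra.
  have [n0 roots] := strong_end_roots b0 ba xiy yD.
  have [X X_root] : {X : nat -> R & forall m, (n0.+1 <= m)%N ->
      limit_shift a b <= X m <= y /\ centre_even a b m (X m)}.
    (* Below the threshold the value 0 is a default; the root found for n belongs to m = n + 1. *)
    apply: (choice (P := fun m x => (n0.+1 <= m)%N ->
      limit_shift a b <= x <= y /\ centre_even a b m x)) => -[|m]; first by exists 0.
    have [n0m|mn0] := leqP n0 m; last by exists 0; rewrite ltnS leqNgt mn0.
    by have [x x_root] := roots m n0m; exists x.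
  exists n0.+1, (fun m => shift_frequency s1 s2 delta (X m)),
    (fun m => shift_decay s1 s2 (X m)), (fun m => centred_mode s1 s2 m 1 (X m)).
  split=> // [[|m] //|_] => [/X_root[/andP[xix xy] root]|].
    apply: strong_end_interface => //; first exact: le_trans (ltW xi0) xix.
    exact: le_lt_trans xy yD.
  have [A [q [A0 q1 estimate]]] := strong_end_decay_estimate s1_gt0 s12 xiy yD.
  have q0 : 0 < q by rewrite (lt_trans ltr01).
  (* With N = 4 m + 1 one has q ^ (- m) = exp (ln q / 4) exp (- (ln q / 4) N). *)
  exists (A * expR (ln q / 4)), (ln q / 4); split; rewrite ?divr_gt0 ?ln_gt0 //.
    by rewrite mulr_gt0 ?expR_gt0.
  move=> [|m] // /X_root[x_int root].
  rewrite beta_iE //; apply: le_trans (estimate _ _ x_int root) _.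
  rewrite -mulrA ler_pM2l // -expRD natrD natrM.
  rewrite (_ : _ + _ = - ln q * m.+1%:R); last by field.
  by rewrite expRM_natr expRN lnK.
have ab : a < b by rewrite /a /b ltf_pV2 ?posrE.
have d0 : 0 < b - a by rewrite subr_gt0.
(* From this size on, u m is negative at the band edge, as [weak_end_odd_exists] requires. *)
pose m1 := Num.bound (a / (b - a)).
have large m : (m1 <= m)%N -> a < 2 * m%:R * (b - a).
  move=> m_ge; rewrite -ltr_pdivrMr //.
  have : a / (b - a) < m1%:R by apply: archi_boundP; rewrite divr_ge0 // ltW.
  have : (m1%:R : R) <= m%:R by rewrite ler_nat.
  have := ler0n R m; lra.
have [X X_root] : {X : nat -> R & forall m, (m1.+1 <= m)%N ->
    [/\ a - b < X m, X m <= 0 & centre_odd a b m (X m)]}.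
  apply: (choice (P := fun m x => (m1.+1 <= m)%N ->
    [/\ a - b < x, x <= 0 & centre_odd a b m x])) => m.
  have [m1m|mm1] := leqP m1 m; last by exists 0; rewrite ltnNge (ltnW mm1).
  by have [x x_root] := weak_end_odd_exists a0 ab (large m m1m); exists x.
exists m1.+1, (fun m => shift_frequency s1 s2 delta (X m)),
  (fun m => shift_decay s1 s2 (X m)), (fun m => centred_mode s1 s2 m (-1) (X m)).
split=> // [[|m] // /X_root[Xlo Xhi root]|s12].
  exact: weak_end_interface.
by have := lt_trans s12 s21; rewrite ltxx.
Qed.
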